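(* Let $\theta>1$ be fixed. For each $n$, let $\mathbf{X}=(X_1,\dots,X_n)^\top$ follow the Curie--Weiss model $\mathbb{P}_{\theta,\boldsymbol{\mu}}$, let $$\tilde X=\frac1n\sum_{i=1}^n\Big[X_i-\tanh\Big(\frac{\theta}{n}\sum_{j\neq i}X_j\Big)\Big],$$ and consider testing $H_0:\boldsymbol{\mu}=\mathbf{0}$ versus $H_1:\boldsymbol{\mu}\in\Xi(s,B)$, where $s=s_n$ and $B=B_n$ may depend on $n$. (i) If $s\tanh(B)\gg n^{1/2}$, then, for a diverging sequence $L_n\to\infty$ such that $L_n=o(n^{-1/2}s\tanh(B))$, the test that rejects $H_0$ if and only if $\sqrt n\,\tilde X\ge L_n$ is asymptotically powerful. (ii) Conversely, if $s\tanh(B)=O(n^{1/2})$, then there is no asymptotically powerful test for this testing problem.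
   Context: The Curie--Weiss model with parameters $\theta\in\mathbb{R}$ and $\boldsymbol{\mu}=(\mu_1,\dots,\mu_n)^\top\in\mathbb{R}^n$ is the probability distribution on $\{\pm1\}^n$ given by $$\mathbb{P}_{\theta,\boldsymbol{\mu}}(\mathbf{X}=\mathbf{x})=\frac{1}{Z(\theta,\boldsymbol{\mu})}\exp\Big(\frac{\theta}{n}\sum_{1\le i<j\le n}x_ix_j+\sum_{i=1}^n\mu_ix_i\Big),\qquad \mathbf{x}\in\{\pm1\}^n,$$ where $Z(\theta,\boldsymbol{\mu})$ is the normalizing constant. For $s\in\{1,\dots,n\}$ and $B>0$, $$\Xi(s,B)=\Big\{\boldsymbol{\mu}\in\mathbb{R}^n: |\mathrm{supp}(\boldsymbol{\mu})|=s,\ \min_{i\in\mathrm{supp}(\boldsymbol{\mu})}\mu_i\ge B\Big\},\qquad \mathrm{supp}(\boldsymbol{\mu})=\{1\le i\le n:\mu_i\neq0\}.$$ A test is a function $T:\{\pm1\}^n\to\{0,1\}$, where the value $1$ means rejecting $H_0$. Its worst-case risk is $$\mathrm{Risk}(T)=\mathbb{P}_{\theta,\mathbf{0}}(T(\mathbf{X})=1)+\sup_{\boldsymbol{\mu}\in\Xi(s,B)}\mathbb{P}_{\theta,\boldsymbol{\mu}}(T(\mathbf{X})=0).$$ A sequence of tests (indexed by $n$) is asymptotically powerful if $\limsup_{n\to\infty}\mathrm{Risk}(T)=0$. All asymptotics are as $n\to\infty$; $a_n\gg b_n$ means $b_n=o(a_n)$. *)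

(* Defs.v *)
From mathcomp Require Import all_boot all_order all_algebra.
From mathcomp Require Import all_classical all_reals all_analysis.
Import Order.TTheory GRing.Theory Num.Theory.
Import numFieldNormedType.Exports.

Set Implicit Arguments.
Unset Strict Implicit.
Unset Printing Implicit Defensive.

Local Open Scope classical_set_scope.
Local Open Scope ring_scope.

Definition tanh (R : realType) (x : R) : R :=
  (expR x - expR (- x)) / (expR x + expR (- x)).

(* A point of {-1, 1}^n is a boolean vector, [true] standing for the spin +1. *)
Definition config (n : nat) : finType := {ffun 'I_n -> bool}.

Definition spin (R : realType) (n : nat) (x : config n) (i : 'I_n) : R :=
  if x i then 1 else -1.

Definition cw_weight (R : realType) (n : nat) (theta : R) (mu : 'rV[R]_n)
    (x : config n) : R :=
  expR (theta / n%:R *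
          (\sum_(i < n) \sum_(j < n | (i < j)%N) spin R x i * spin R x j)
        + \sum_(i < n) mu ord0 i * spin R x i).

Definition cw_Z (R : realType) (n : nat) (theta : R) (mu : 'rV[R]_n) : R :=
  \sum_(x : config n) cw_weight theta mu x.

Definition cw_pmf (R : realType) (n : nat) (theta : R) (mu : 'rV[R]_n)
    (x : config n) : R :=
  cw_weight theta mu x / cw_Z theta mu.

Definition cw_prob (R : realType) (n : nat) (theta : R) (mu : 'rV[R]_n)
    (A : pred (config n)) : R :=
  \sum_(x : config n | A x) cw_pmf theta mu x.

Definition supp (R : realType) (n : nat) (mu : 'rV[R]_n) : {set 'I_n} :=
  [set i : 'I_n | mu ord0 i != 0]%SET.

Definition Xi (R : realType) (n s : nat) (B : R) : set 'rV[R]_n :=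
  [set mu | #|supp mu| = s /\ forall i, i \in supp mu -> B <= mu ord0 i].

(* [true] means that the null hypothesis is rejected. *)
Definition test (n : nat) : Type := config n -> bool.

(* For 0 < s <= n the set below is nonempty and contained in [0, 1], so that
   [sup] is a genuine supremum. *)
Definition risk (R : realType) (n : nat) (theta : R) (s : nat) (B : R)
    (T : test n) : R :=
  cw_prob theta (0 : 'rV[R]_n) (fun x => T x)
  + sup [set cw_prob theta mu (fun x => ~~ T x) | mu in @Xi R n s B].

Definition asymptotically_powerful (R : realType) (theta : R) (s : nat -> nat)
    (B : nat -> R) (T : forall n, test n) : Prop :=
  limn_sup (fun n => risk theta (s n) (B n) (T n)) = 0.

Definition Xtilde (R : realType) (n : nat) (theta : R) (x : config n) : R :=
  n%:R^-1 * \sum_(i < n)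
    (spin R x i - tanh (theta / n%:R * \sum_(j < n | j != i) spin R x j)).

Definition Xtilde_test (R : realType) (theta : R) (L : nat -> R) (n : nat)
    : test n :=
  fun x => L n <= Num.sqrt n%:R * Xtilde theta x.

(* Main.v *)
(* Write m for the mean spin and f(u) = u - tanh(theta u).  Given the other spins,
   X_i has mean tanh(theta m_i + mu_i), where m_i leaves out spin i; the resulting
   residuals are nearly orthogonal, so their sum D has second moment O(n) under
   every mu.

   (i) sqrt n * Xtilde is D / sqrt n plus a drift which vanishes under the null
   and is at least a constant times s tanh(B) / sqrt n under the alternative;
   conclude by Chebyshev.

   (ii) Average the alternatives over all permutations of a fixed mu in Xi, with
   A = sum_i tanh(mu_i) = O(sqrt n).  The averaged likelihood ratio depends only
   on the number of + spins.  With probability at least 1/4, both under mu and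
   under the null, that number lies in a window of width O(sqrt n) around the
   positive root of f: D = O(sqrt n) forces f(m) = O(1 / sqrt n), positive
   magnetization has probability at least 1/2, and a neighbourhood of m = 0 is
   unlikely because the law of the number of + spins increases as long as f <= 0
   (this is where theta > 1 enters).  Flipping a single spin changes the
   likelihood ratio by a factor 1 + O(A / n), hence over the window it varies by a
   bounded factor only, and the risk stays bounded away from 0. *)
Require Import Defs.
From mathcomp Require Import all_boot all_order all_algebra.
From mathcomp Require Import all_classical all_reals all_analysis.
From mathcomp Require Import perm ring lra zify.
Import Order.TTheory GRing.Theory Num.Theory.
Import numFieldNormedType.Exports.
Local Open Scope classical_set_scope.
Local Open Scope ring_scope.

(** * The hyperbolic tangent and the mean-field equation *)

Section Tanh.
Context {R : realType}.
Implicit Types a b x y z : R.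

Lemma tanhE x : tanh x = 1 - 2 / (expR (2 * x) + 1).
Proof.
rewrite /tanh expRN (_ : 2 * x = x + x); last by ring.
rewrite expRD; have h := expR_gt0 x.
have h2 : expR x * expR x + 1 != 0 by apply: lt0r_neq0; nra.
move: (expR x) h h2 => e h h2.
have e0 : e != 0 by apply: lt0r_neq0.
by field; rewrite h2.
Qed.

Lemma tanh0 : tanh (0 : R) = 0.
Proof. by rewrite /tanh oppr0 subrr mul0r. Qed.

Lemma tanhN x : tanh (- x) = - tanh x.
Proof. by rewrite /tanh opprK -mulNr opprB [X in _ / X]addrC. Qed.

Lemma tanh_lt1 x : tanh x < 1.
Proof.
by rewrite tanhE ltrBlDr ltrDl divr_gt0.
Qed.

Lemma tanh_gtN1 x : -1 < tanh x.
Proof. by rewrite ltrNl -tanhN tanh_lt1. Qed.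

Lemma ler_tanh x y : x <= y -> tanh x <= tanh y.
Proof.
move=> xy; rewrite !tanhE lerB// ler_pM2l// lef_pV2 ?posrE.
- by rewrite lerD2r ler_expR; lra.
- by have := expR_gt0 (2 * y); lra.
- by have := expR_gt0 (2 * x); lra.
Qed.

Lemma tanh_ge0 x : 0 <= x -> 0 <= tanh x.
Proof. by move=> x0; rewrite -tanh0 ler_tanh. Qed.

(** The subtraction formula for tanh with its denominator cleared; it factors the effect of a field
    [b] on a conditional mean. *)
Lemma tanh_subD a b : tanh (a + b) - tanh a = tanh b * (1 - tanh a * tanh (a + b)).
Proof.
rewrite !tanhE mulrDr expRD.
have := expR_gt0 (2 * a); have := expR_gt0 (2 * b).
move: (expR (2 * a)) (expR (2 * b)) => u v v0 u0.
field; rewrite !lt0r_neq0//; nra.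
Qed.

(** The factor 4 is crude: the second factor in [tanh_subD] is at most 2, and [tanh d <= 2 * d] for
    [0 <= d]. *)
Lemma tanh_lip a b : `|tanh a - tanh b| <= 4 * `|a - b|.
Proof.
wlog ab : a b / b <= a => [h|].
  have [/h //|/ltW/h] := leP b a.
  by rewrite distrC [X in _ <= 4 * X]distrC.
have d0 : 0 <= a - b by lra.
rewrite !ger0_norm ?subr_ge0 ?ler_tanh//.
rewrite {1}(_ : a = b + (a - b)); last by ring.
rewrite tanh_subD (_ : b + (a - b) = a); last by ring.
have t0 := tanh_ge0 _ d0.
have t1 : tanh (a - b) <= 2 * (a - b).
  have e1 := expR_ge1Dx (- (2 * (a - b))).
  have e2 := expR_gt0 (- (2 * (a - b))).
  rewrite tanhE -[X in expR X]opprK expRN.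
  move: e1 e2; move: (expR (- _)) => e e1 e2.
  have -> : 2 / (e^-1 + 1) = 2 * e / (1 + e).
    by field; rewrite !lt0r_neq0//; lra.
  rewrite lerBlDr -lerBlDl ler_pdivlMr; nra.
have := tanh_lt1 a; have := tanh_gtN1 a.
have := tanh_lt1 b; have := tanh_gtN1 b.
move=> *; have : tanh b * tanh a >= -1 by nra.
by move=> *; nra.
Qed.

Lemma tanh_ge_frac x : 0 <= x -> x / (1 + x) <= tanh x.
Proof.
move=> x0; have e1 := expR_ge1Dx (2 * x).
have -> : x / (1 + x) = 1 - 2 / (2 * x + 1 + 1).
  by field; rewrite !lt0r_neq0//; lra.
by rewrite tanhE lerB// ler_pM2l// lef_pV2 ?posrE; lra.
Qed.

Lemma is_derive_tanh x : is_derive x 1 (@tanh R) (1 - tanh x ^+ 2).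
Proof.
have -> : (@tanh R) =
    (fun x => (expR x - expR (- x)) * (expR x + expR (- x))^-1).
  by [].
have h : expR x + expR (- x) != 0.
  by apply: lt0r_neq0; rewrite addr_gt0 ?expR_gt0.
apply: is_derive_eq.
rewrite /tanh /GRing.scale /=; field.
by [].
Qed.

(* Chord slopes of tanh decrease on the positive half-line, since its derivative
   [1 - tanh ^ 2] does. *)
Lemma tanh_chord x y z : 0 <= x -> x <= y -> y <= z ->
  (tanh z - tanh y) * (y - x) <= (tanh y - tanh x) * (z - y).
Proof.
move=> x0; rewrite le_eqVlt => /predU1P[-> _|xy].
  by rewrite !subrr !(mulr0, mul0r).
rewrite le_eqVlt => /predU1P[->|yz]; first by rewrite !subrr !(mulr0, mul0r).
have tc (a b : R) : {within `[a, b], continuous (@tanh R)}.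
  apply: derivable_within_continuous => u _.
  by have [] := is_derive_tanh u.
have [c /itvP hc ->] := MVT xy (fun u _ => is_derive_tanh u) (tc x y).
have [d /itvP hd ->] := MVT yz (fun u _ => is_derive_tanh u) (tc y z).
have cd : tanh c <= tanh d by apply: ler_tanh; apply: (@le_trans _ _ y); rewrite ?hc ?hd.
have c0 : 0 <= tanh c by apply: tanh_ge0; apply: le_trans x0 _; rewrite hc.
rewrite -!mulrA [(y - x) * _]mulrC ler_pM2r ?mulr_gt0 ?subr_gt0//.
by nra.
Qed.

End Tanh.

(** * Convexity of the mean-field defect on the positive half-line *)

Section MeanField.
Context {R : realType} (theta : R) (theta_gt1 : 1 < theta).

Definition mf_defect (u : R) : R := u - tanh (theta * u).

(** An explicit point with negative defect: [theta * mf_step = (theta - 1) / 2] is less than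
    [theta - 1], so that [tanh_ge_frac] gives [tanh (theta * mf_step) > mf_step]. *)
Definition mf_step : R := (theta - 1) / (2 * theta).

Lemma mf_step_gt0 : 0 < mf_step.
Proof.
have t1 := theta_gt1.
by apply: divr_gt0; lra.
Qed.

Lemma mf_step_lt1 : mf_step < 1.
Proof.
have t1 := theta_gt1.
by rewrite ltr_pdivrMr; lra.
Qed.

Lemma mf_defect_step_lt0 : mf_defect mf_step < 0.
Proof.
have t1 := theta_gt1.
rewrite subr_lt0.
have d0 := mf_step_gt0.
apply: lt_le_trans (tanh_ge_frac _ _); last by nra.
rewrite ltr_pdivlMr; last by nra.
rewrite mulrC ltr_pM2r//.
have -> : theta * mf_step = (theta - 1) / 2.
  by rewrite /mf_step; field; lra.
by lra.
Qed.

(** Convexity of the defect, a linear function minus a concave one, in division-free form. *)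
Lemma mf_defect_chord x y z : 0 <= x -> x <= y -> y <= z ->
  (mf_defect y - mf_defect x) * (z - y) <= (mf_defect z - mf_defect y) * (y - x).
Proof.
have t1 := theta_gt1.
move=> x0 xy yz; have t0 : 0 < theta by lra.
have := tanh_chord _ _ _ (mulr_ge0 (ltW t0) x0) _ _.
move=> /(_ (theta * y) (theta * z)); rewrite !ler_pM2l// => /(_ xy yz).
rewrite -!mulrBr ![_ * (theta * _)]mulrCA ler_pM2l// /mf_defect.
by nra.
Qed.

(** The defect vanishes at 0, so convexity puts it below its chord to [mf_step], whose slope is
    negative. A small defect on this range forces a small [u]. *)
Lemma mf_defect_le u : 0 <= u -> u <= mf_step ->
  mf_defect u <= u * (mf_defect mf_step / mf_step).
Proof.
have t1 := theta_gt1.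
move=> u0 ud; have d0 := mf_step_gt0.
rewrite mulrA ler_pdivlMr//.
have := @mf_defect_chord 0 u mf_step (lexx _) u0 ud.
rewrite {2}/mf_defect mulr0 tanh0 !subr0.
by nra.
Qed.

Lemma mf_defect_le0 u : 0 <= u -> u <= mf_step -> tanh (theta * u) >= u.
Proof.
have t1 := theta_gt1.
move=> u0 ud; rewrite -subr_le0; apply: le_trans (mf_defect_le _ u0 ud) _.
rewrite mulr_ge0_le0// mulr_le0_ge0// ?invr_ge0 ltW//; first exact: mf_defect_step_lt0.
exact: mf_step_gt0.
Qed.

(** From [mf_step] to [u], a distance of at most 1, the defect rises by at least
    [- (mf_defect mf_step / 2)]; by convexity the slope beyond [u] is no smaller. Near the positive
    root the defect thus controls distances. *)
Lemma mf_defect_expand u v : mf_step <= u -> u <= v -> u <= 1 ->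
  mf_defect mf_step / 2 <= mf_defect u ->
  - (mf_defect mf_step / 2) * (v - u) <= mf_defect v - mf_defect u.
Proof.
have t1 := theta_gt1.
move=> du uv u1 fu; have d0 := mf_step_gt0; have f0 := mf_defect_step_lt0.
have ud : mf_step < u.
  rewrite lt_neqAle du andbT; apply/eqP => eu.
  by rewrite -eu in fu; lra.
have := mf_defect_chord mf_step u v (ltW d0) du uv.
move=> h; rewrite -(@ler_pM2r _ (u - mf_step)) ?subr_gt0//.
apply: le_trans h.
rewrite -mulrA [X in _ * X]mulrC mulrA ler_wpM2r ?subr_ge0//.
by nra.
Qed.

End MeanField.

(** * Residuals of the Curie-Weiss model *)

Section Spins.
Context {R : realType} {n : nat}.
Implicit Types (x : config n) (i j : 'I_n).

Definition flip i x : config n := [ffun j => (j == i) (+) x j].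

Lemma flipK i : involutive (flip i).
Proof. by move=> x; apply/ffunP => j; rewrite !ffunE addbA addbb. Qed.

Lemma spin_flip i x j : spin R (flip i x) j = if j == i then - spin R x j else spin R x j.
Proof. by rewrite /spin ffunE; case: eqP => //= _; case: (x j); rewrite ?opprK. Qed.

Lemma spin_sqr x i : spin R x i * spin R x i = 1.
Proof. by rewrite /spin; case: (x i); rewrite ?mulrNN mulr1. Qed.

Lemma norm_spin x i : `|spin R x i| = 1.
Proof. by rewrite /spin; case: (x i); rewrite ?normrN normr1. Qed.

Lemma natr_gt0_ord i : 0 < (n%:R : R).
Proof. by rewrite ltr0n (leq_ltn_trans _ (ltn_ord i)). Qed.

Definition mag x : R := \sum_i spin R x i.

Definition cavity i x : R := \sum_(j | j != i) spin R x j.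

Lemma magE i x : mag x = spin R x i + cavity i x.
Proof. by rewrite /mag (bigD1 i). Qed.

Lemma cavity_flip i x : cavity i (flip i x) = cavity i x.
Proof. by apply: eq_bigr => j /negPf ji; rewrite spin_flip ji. Qed.

Lemma cavity_split i j x : i != j ->
  cavity j x = spin R x i + \sum_(k | (k != j) && (k != i)) spin R x k.
Proof. by move=> ij; rewrite /cavity (bigD1 i). Qed.

Lemma norm_cavity_le i x : `|cavity i x| <= n%:R.
Proof.
apply: le_trans (ler_norm_sum _ _ _) _.
under eq_bigr do rewrite norm_spin.
by rewrite sumr_const ler_nat (leq_trans (max_card _))// card_ord.
Qed.

Lemma pair_sum_mag x :
  \sum_(i < n) \sum_(j < n | (i < j)%N) spin R x i * spin R x j
    = (mag x ^+ 2 - n%:R) / 2.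
Proof.
set P := LHS.
suff -> : mag x ^+ 2 = n%:R + P + P by field.
have swapP : P = \sum_(i < n) \sum_(j < n | (j < i)%N) spin R x i * spin R x j.
  rewrite /P (exchange_big_dep xpredT)//=; apply: eq_bigr => i _.
  by apply: eq_bigr => j _; rewrite mulrC.
have -> : n%:R = \sum_(i < n) spin R x i * spin R x i.
  by under eq_bigr do rewrite spin_sqr; rewrite sumr_const card_ord.
rewrite {2}swapP -!big_split /= expr2 /mag mulr_suml; apply: eq_bigr => i _.
rewrite mulr_sumr (bigD1 i)//= -!addrA; congr (_ + _).
rewrite (bigID (fun j : 'I_n => (i < j)%N))/=; congr (_ + _).
  by apply: eq_bigl => j; rewrite -val_eqE /=; case: ltngtP.
by apply: eq_bigl => j; rewrite -val_eqE /=; case: ltngtP.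
Qed.

End Spins.

Section Model.
Context {R : realType} {n : nat} (theta : R) (mu : 'rV[R]_n).
Implicit Types (x : config n) (i j : 'I_n).

Definition site_field i x : R := theta / n%:R * cavity i x + mu ord0 i.

Definition resid i x : R := spin R x i - tanh (site_field i x).

Lemma cw_weightE x : cw_weight theta mu x =
  expR (theta / (2 * n%:R) * (mag x ^+ 2 - n%:R)
        + \sum_(i < n) mu ord0 i * spin R x i).
Proof.
rewrite /cw_weight pair_sum_mag invfM; congr expR; congr +%R.
by move: (n%:R^-1) (mag x ^+ 2 - n%:R) => a b; field.
Qed.

Lemma cw_weight_gt0 x : 0 < cw_weight theta mu x.
Proof. exact: expR_gt0. Qed.

Lemma cw_Z_gt0 : 0 < cw_Z theta mu.
Proof.
rewrite /cw_Z (bigD1 [ffun => true])//= ltr_pwDl ?cw_weight_gt0// sumr_ge0// => x _.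
exact/ltW/cw_weight_gt0.
Qed.

Lemma cw_pmf_ge0 x : 0 <= cw_pmf theta mu x.
Proof. by rewrite divr_ge0// ltW ?cw_weight_gt0 ?cw_Z_gt0. Qed.

Lemma cw_pmf_sum1 : \sum_x cw_pmf theta mu x = 1.
Proof. by rewrite -mulr_suml divff// gt_eqF ?cw_Z_gt0. Qed.

Lemma cw_prob_ge0 A : 0 <= cw_prob theta mu A.
Proof. by apply: sumr_ge0 => x _; exact: cw_pmf_ge0. Qed.

Lemma cw_probC A : cw_prob theta mu (predC A) = 1 - cw_prob theta mu A.
Proof. by rewrite -cw_pmf_sum1 (bigID A)/= addrC addrK. Qed.

Lemma cw_prob_le1 A : cw_prob theta mu A <= 1.
Proof. by rewrite -subr_ge0 -cw_probC cw_prob_ge0. Qed.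

Lemma le_cw_prob (A A' : pred (config n)) :
  (forall x, A x -> A' x) -> cw_prob theta mu A <= cw_prob theta mu A'.
Proof.
move=> AA'; rewrite /cw_prob [leLHS]big_mkcond [leRHS]big_mkcond/=.
apply: ler_sum => x _; case: ifPn => [/AA' ->//|_].
by case: ifP => // _; exact: cw_pmf_ge0.
Qed.

Lemma weight_flip i x :
  cw_weight theta mu (flip i x) =
    cw_weight theta mu x * expR (- (2 * spin R x i * site_field i x)).
Proof.
rewrite !cw_weightE -expRD; congr expR.
rewrite !(magE i) cavity_flip spin_flip eqxx /site_field.
rewrite (bigD1 i)//= [X in _ = _ + X + _](bigD1 i)//= spin_flip eqxx.
have -> : \sum_(j < n | j != i) mu ord0 j * spin R (flip i x) j
        = \sum_(j < n | j != i) mu ord0 j * spin R x j.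
  by apply: eq_bigr => j /negPf ji; rewrite spin_flip ji.
have n0 : (n%:R : R) != 0 by rewrite gt_eqF ?(natr_gt0_ord i).
by field.
Qed.

(* Given the other spins, [X_i] has mean [tanh (site_field i)]: pairing each
   configuration with its flip at [i] cancels the sum. *)
Lemma resid_orthogonal i (g : config n -> R) : (forall x, g (flip i x) = g x) ->
  \sum_x cw_pmf theta mu x * (resid i x * g x) = 0.
Proof.
move=> gi; set S := LHS.
suff : S + S = 0 by move=> ?; lra.
rewrite {2}/S (reindex_inj (inv_inj (flipK i))) -big_split /= big1// => x _.
rewrite gi /cw_pmf weight_flip {2}/resid /site_field cavity_flip.
rewrite spin_flip eqxx -!/(site_field i x).
transitivity (cw_weight theta mu x / cw_Z theta mu * g x * (resid i x +
  expR (- (2 * spin R x i * site_field i x)) * (- spin R x i - tanh (site_field i x)))).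
  by ring.
rewrite /resid.
suff -> : spin R x i - tanh (site_field i x) +
  expR (- (2 * spin R x i * site_field i x)) * (- spin R x i - tanh (site_field i x)) = 0.
  by rewrite !(mul0r, mulr0).
rewrite tanhE; move: (site_field i x) => h; rewrite /spin; case: (x i).
  rewrite mulr1 expRN; have := expR_gt0 (2 * h); move: (expR _) => e e0.
  by field; rewrite !lt0r_neq0//; lra.
rewrite mulrN1 mulNr opprK; have := expR_gt0 (2 * h); move: (expR _) => e e0.
by field; rewrite !lt0r_neq0//; lra.
Qed.

Lemma norm_resid_le i x : `|resid i x| <= 2.
Proof.
apply: le_trans (ler_normB _ _) _; rewrite norm_spin.
have := tanh_lt1 (site_field i x); have := tanh_gtN1 (site_field i x) => a b.
have : `|tanh (site_field i x)| <= 1 by rewrite ler_norml !ltW.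
by lra.
Qed.

(** Removing spin [i] from the field at [j] turns [resid j] into a function [g] invariant under the
    flip at [i], to which [resid_orthogonal] applies. The replacement costs [4 * theta / n%:R] by
    [tanh_lip], and [resid i] contributes a factor 2. *)
Lemma resid_cov i j : i != j -> 0 <= theta ->
  `|\sum_x cw_pmf theta mu x * (resid i x * resid j x)| <= 8 * theta / n%:R.
Proof.
move=> ij th0.
pose g x := spin R x j - tanh (site_field j x - theta / n%:R * spin R x i).
have gi x : g (flip i x) = g x.
  rewrite /g !spin_flip eqxx eq_sym (negPf ij) /site_field !(cavity_split _ _ _ ij).
  rewrite spin_flip eqxx (eq_bigr (spin R x)); last first.
    by move=> k /andP[_ /negPf ki]; rewrite spin_flip ki.
  by congr (_ - tanh _); ring.
have n0 : 0 < (n%:R : R) := natr_gt0_ord i.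
rewrite -[X in `|X|]subr0 -[X in _ - X](resid_orthogonal _ _ gi) -sumrB.
apply: le_trans (ler_norm_sum _ _ _) _.
have -> : 8 * theta / n%:R = \sum_x cw_pmf theta mu x * (8 * theta / n%:R).
  by rewrite -mulr_suml cw_pmf_sum1 mul1r.
apply: ler_sum => x _.
rewrite -mulrBr -mulrBr normrM ger0_norm ?cw_pmf_ge0// ler_wpM2l ?cw_pmf_ge0//.
rewrite normrM (_ : 8 * theta / n%:R = 2 * (4 * `|theta / n%:R|)); last first.
  by rewrite ger0_norm ?divr_ge0// mulrA (_ : 2 * 4 = 8) ?mulrA//; ring.
apply: ler_pM => //; first exact: norm_resid_le.
rewrite /resid /g opprB addrC addrA subrK.
apply: le_trans (tanh_lip _ _) _.
by rewrite addrAC subrr add0r normrN normrM norm_spin mulr1.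
Qed.

(** Each of the [n] rows of the covariance sum has a diagonal term of at most 4 and off-diagonal
    terms totalling at most [8 * theta]. The bound is uniform in [mu], so it serves the null and the
    alternatives alike. *)
Lemma resid_second_moment : 0 <= theta ->
  \sum_x cw_pmf theta mu x * (\sum_i resid i x) ^+ 2 <= (4 + 8 * theta) * n%:R.
Proof.
move=> th0.
have -> : \sum_x cw_pmf theta mu x * (\sum_i resid i x) ^+ 2 =
    \sum_i \sum_j \sum_x cw_pmf theta mu x * (resid i x * resid j x).
  under [RHS]eq_bigr do rewrite exchange_big/=.
  rewrite exchange_big/=; apply: eq_bigr => x _.
  rewrite expr2 mulr_suml mulr_sumr; apply: eq_bigr => i _.
  by rewrite !mulr_sumr.
have -> : (4 + 8 * theta) * n%:R = \sum_(i < n) (4 + 8 * theta).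
  by rewrite sumr_const card_ord mulr_natr.
apply: ler_sum => i _; rewrite (bigD1 i)//= lerD//.
  apply: (@le_trans _ _ (\sum_x cw_pmf theta mu x * 4)); last first.
    by rewrite -mulr_suml cw_pmf_sum1 mul1r.
  apply: ler_sum => x _.
  rewrite ler_wpM2l ?cw_pmf_ge0//; have := norm_resid_le i x.
  by rewrite ler_norml => /andP[a b]; nra.
have n0 : 0 < (n%:R : R) := natr_gt0_ord i.
apply: (@le_trans _ _ (\sum_(j < n | j != i) 8 * theta / n%:R)).
  apply: ler_sum => j ji; apply: le_trans (ler_norm _) _.
  by apply: resid_cov; rewrite // eq_sym.
apply: (@le_trans _ _ (\sum_(j < n) 8 * theta / n%:R)).
  rewrite [leRHS](bigD1 i)//= lerDr; apply: divr_ge0; last exact: ltW.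
  by apply: mulr_ge0.
by rewrite sumr_const card_ord -[leLHS]mulr_natr divfK ?gt_eqF.
Qed.

Lemma resid_chebyshev (a : R) : 0 <= theta -> 0 <= a ->
  cw_prob theta mu (fun x => a <= `|\sum_i resid i x|) * a ^+ 2
    <= (4 + 8 * theta) * n%:R.
Proof.
move=> th0 a0; apply: le_trans (resid_second_moment th0).
rewrite /cw_prob mulr_suml [leRHS](bigID (fun x => a <= `|\sum_i resid i x|))/=.
rewrite ler_wpDr//.
  by apply: sumr_ge0 => x _; rewrite mulr_ge0 ?cw_pmf_ge0 ?sqr_ge0.
apply: ler_sum => x ax; rewrite ler_wpM2l ?cw_pmf_ge0//.
by rewrite -[leRHS]real_normK ?num_real// lerXn2r ?nnegrE.
Qed.

(** What the field adds to the conditional mean of spin [i]; [Xtilde] centres by the null mean and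
    therefore retains it. *)
Definition drift i x : R := tanh (site_field i x) - tanh (theta / n%:R * cavity i x).

Lemma driftE i x : drift i x = tanh (mu ord0 i) *
  (1 - tanh (theta / n%:R * cavity i x) * tanh (site_field i x)).
Proof. by rewrite /drift /site_field tanh_subD. Qed.

Lemma drift_le i x : 0 <= mu ord0 i -> drift i x <= 2 * tanh (mu ord0 i).
Proof.
move=> /tanh_ge0 m0; rewrite driftE mulrC ler_wpM2r//.
move: (theta / n%:R * _) (site_field i x) => u v.
have := tanh_lt1 u; have := tanh_gtN1 u; have := tanh_lt1 v; have := tanh_gtN1 v.
by nra.
Qed.

(** The cavity sum is at most [n] in absolute value, so the tanh of the null field is at most
    [tanh theta] in absolute value, whatever the configuration. *)
Lemma drift_ge i x : 0 <= theta -> 0 <= mu ord0 i ->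
  (1 - tanh theta) * tanh (mu ord0 i) <= drift i x.
Proof.
move=> th0 mi; have m0 := tanh_ge0 _ mi; rewrite driftE mulrC ler_wpM2l//.
have n0 : 0 < (n%:R : R) := natr_gt0_ord i.
have := norm_cavity_le (R := R) i x; rewrite ler_norml => /andP[c1 c2].
have := tanh_lt1 (site_field i x); have := tanh_gtN1 (site_field i x).
have ub : tanh (theta / n%:R * cavity i x) <= tanh theta.
  apply: ler_tanh; rewrite -mulrA ler_piMr// mulrC ler_pdivrMr//.
  by rewrite mul1r.
have lb : - tanh theta <= tanh (theta / n%:R * cavity i x).
  rewrite -tanhN; apply: ler_tanh; rewrite -mulrA -mulrN1 ler_wpM2l// mulrC.
  by rewrite ler_pdivlMr// mulN1r.
by have := tanh_ge0 _ th0; nra.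
Qed.

Lemma drift_ge0 i x : 0 <= theta -> 0 <= mu ord0 i -> 0 <= drift i x.
Proof.
move=> th0 mi; apply: le_trans (drift_ge _ _ th0 mi).
by rewrite mulr_ge0 ?tanh_ge0// subr_ge0 ltW ?tanh_lt1.
Qed.

End Model.

(** * Risk, and the test based on Xtilde *)

Section Risk.
Context {R : realType} {n : nat} (theta : R) (s : nat) (B : R) (T : test n).

Let errs := [set cw_prob theta mu (fun x => ~~ T x) | mu in @Xi R n s B].

Lemma has_ubound_type2 : has_ubound errs.
Proof. by exists 1 => _ [mu _ <-]; exact: cw_prob_le1. Qed.

Lemma risk_ge0 : 0 <= risk theta s B T.
Proof.
rewrite addr_ge0 ?cw_prob_ge0//.
have [[y ey]|/set0P/negP/negPn/eqP e0] := pselect (errs !=set0).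
  apply: le_trans (ub_le_sup has_ubound_type2 ey).
  by case: ey => mu _ <-; exact: cw_prob_ge0.
by rewrite -/errs e0 sup0.
Qed.

Lemma risk_ge (mu : 'rV[R]_n) : Xi s B mu ->
  cw_prob theta (0 : 'rV[R]_n) (fun x => T x) + cw_prob theta mu (fun x => ~~ T x)
    <= risk theta s B T.
Proof. by move=> Xmu; rewrite lerD2l (ub_le_sup has_ubound_type2)//; exists mu. Qed.

(** If there is no alternative, the set of errors is empty and its [sup] is the default 0, whence
    [0 <= e2]. *)
Lemma risk_le e1 e2 : cw_prob theta (0 : 'rV[R]_n) (fun x => T x) <= e1 -> 0 <= e2 ->
  (forall mu : 'rV[R]_n, Xi s B mu -> cw_prob theta mu (fun x => ~~ T x) <= e2) ->
  risk theta s B T <= e1 + e2.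
Proof.
move=> h1 e20 h2; apply: lerD => //.
have [ne|/set0P/negP/negPn/eqP e0] := pselect (errs !=set0).
  by apply: ge_sup => // _ [mu Xmu <-]; exact: h2.
by rewrite -/errs e0 sup0.
Qed.

Lemma risk_le2 : risk theta s B T <= 2.
Proof.
rewrite (_ : 2 = 1 + 1)//; apply: risk_le => // [|mu _]; exact: cw_prob_le1.
Qed.

End Risk.

Section Powerful.
Context {R : realType}.

(** The risk lies between 0 and 2: boundedness makes the limit superior the infimum of the tail
    suprema, and nonnegativity turns a zero limit superior into convergence to 0. *)
Lemma asymptotically_powerfulP (theta : R) s B (T : forall n, test n) :
  asymptotically_powerful theta s B T <->
  forall e : R, 0 < e -> \forall n \near \oo, risk theta (s n) (B n) (T n) < e.
Proof.
split=> [h e e0|h].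
- set u := (fun n => risk theta (s n) (B n) (T n)) : (R^o)^nat.
  have bu : bounded_fun u.
    exists 2; split=> [|M M2 n _]; first exact: num_real.
    rewrite /= ger0_norm ?risk_ge0//; apply: le_trans (ltW M2).
    exact: risk_le2.
  rewrite /asymptotically_powerful limn_supE// in h.
  have : has_inf (range (sups u)).
    split; first by exists (sups u 0%N), 0%N.
    exists 0 => _ [n _ <-]; apply: le_trans (risk_ge0 theta (s n) (B n) (T n)) _.
    apply: ub_le_sup; last by exists n => //=.
    exact/has_ubound_sdrop/bounded_fun_has_ubound.
  move=> /(inf_adherent e0)[_ [N _ <-]]; rewrite h add0r => sN.
  exists N => // n /= Nn; apply: le_lt_trans sN.
  apply: ub_le_sup; last by exists n.
  exact/has_ubound_sdrop/bounded_fun_has_ubound.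
- apply: (cvg_limn_inf_sup _).2.
  apply/cvgrPdist_lt => e /h; apply: filterS => n.
  by rewrite sub0r normrN ger0_norm ?risk_ge0.
Qed.

End Powerful.

(** * Error bounds for the [Xtilde] test *)

Section Achievability.
Context {R : realType} {n : nat} (theta : R) (theta_gt1 : 1 < theta).

(** Valid for every [mu]: the tanh of the site field is subtracted in the residual and added back in
    the drift. The second factor [Num.sqrt n%:R] avoids a division. *)
Lemma sqrt_Xtilde (mu : 'rV[R]_n) x : (0 < n)%N ->
  Num.sqrt n%:R * Xtilde theta x * Num.sqrt n%:R
    = \sum_i resid theta mu i x + \sum_i drift theta mu i x.
Proof.
move=> n0; rewrite mulrAC -expr2 sqr_sqrtr ?ler0n// /Xtilde mulrA divff; last first.
  by rewrite pnatr_eq0 -lt0n.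
rewrite mul1r -big_split/=; apply: eq_bigr => i _.
by rewrite /resid /drift /cavity addrA subrK.
Qed.

Lemma Xtilde_type1 (L : nat -> R) : (0 < n)%N -> 0 < L n ->
  cw_prob theta (0 : 'rV[R]_n) (fun x => Xtilde_test theta L x)
    <= (4 + 8 * theta) / L n ^+ 2.
Proof.
move=> n0 L0; have t1 := theta_gt1.
have rn0 : 0 < Num.sqrt (n%:R : R) by rewrite sqrtr_gt0 ltr0n.
rewrite ler_pdivlMr ?exprn_gt0// -(@ler_pM2r _ n%:R) ?ltr0n//.
have th0 : 0 <= theta by lra.
have cheb := resid_chebyshev theta (0 : 'rV[R]_n) _ th0 (mulr_ge0 (ltW L0) (ltW rn0)).
rewrite exprMn sqr_sqrtr ?ler0n// mulrA in cheb; apply: le_trans cheb.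
rewrite !ler_pM2r ?ltr0n ?exprn_gt0//; apply: le_cw_prob => x.
rewrite /Xtilde_test -(@ler_pM2r _ (Num.sqrt n%:R))// (sqrt_Xtilde 0)//.
rewrite [X in _ + X]big1 ?addr0 => [h|i _].
  exact: le_trans (ler_norm _).
by rewrite driftE mxE tanh0 mul0r.
Qed.

(** The total drift is at least [a], while acceptance keeps residuals plus drift below [a / 2]; the
    residual sum is then below [- (a / 2)], which Chebyshev's inequality makes unlikely. *)
Lemma Xtilde_type2 (L : nat -> R) s (B : R) (mu : 'rV[R]_n) : (0 < n)%N -> 0 < B ->
  0 < s%:R * tanh B ->
  2 * L n * Num.sqrt n%:R <= (1 - tanh theta) * (s%:R * tanh B) -> Xi s B mu ->
  cw_prob theta mu (fun x => ~~ Xtilde_test theta L x)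
    <= 4 * (4 + 8 * theta) / (1 - tanh theta) ^+ 2
       * (Num.sqrt n%:R / (s%:R * tanh B)) ^+ 2.
Proof.
move=> n0 B0 sB0 LB [ssupp muB]; have t1 := theta_gt1; have tt := tanh_lt1 theta.
have rn0 : 0 < Num.sqrt (n%:R : R) by rewrite sqrtr_gt0 ltr0n.
set a := (1 - tanh theta) * (s%:R * tanh B).
have a0 : 0 < a by rewrite mulr_gt0 ?subr_gt0.
have -> : 4 * (4 + 8 * theta) / (1 - tanh theta) ^+ 2
       * (Num.sqrt n%:R / (s%:R * tanh B)) ^+ 2 = (4 + 8 * theta) * n%:R / (a / 2) ^+ 2.
  rewrite -[X in _ * X / (a / 2) ^+ 2](@sqr_sqrtr _ n%:R) ?ler0n// /a.
  have : 0 < 1 - tanh theta by rewrite subr_gt0.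
  move: sB0; move: (s%:R * tanh B) (1 - tanh theta) (Num.sqrt n%:R) => u v r u0 v0.
  by field; rewrite !lt0r_neq0.
have a20 : 0 <= a / 2 by lra.
rewrite ler_pdivlMr; last by rewrite exprn_gt0//; lra.
apply: le_trans (@resid_chebyshev R n theta mu (a / 2) _ _) => //; last by lra.
rewrite ler_wpM2r ?sqr_ge0//; apply: le_cw_prob => x.
rewrite /Xtilde_test -(@ler_pM2r _ (Num.sqrt n%:R))// (sqrt_Xtilde mu)// -ltNge.
suff : a <= \sum_i drift theta mu i x.
  move=> h1 h2; rewrite -normrN; apply: le_trans (ler_norm _).
  by rewrite -/a in LB; lra.
have mu0 i : 0 <= mu ord0 i.
  have [/muB|] := boolP (i \in supp mu); first by lra.
  by rewrite inE negbK => /eqP->.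
apply: (@le_trans _ _ (\sum_(i in supp mu) drift theta mu i x)); last first.
  rewrite [leRHS](bigID (mem (supp mu)))/= lerDl sumr_ge0// => i _.
  by apply: drift_ge0 => //; lra.
have -> : a = \sum_(i in supp mu) (1 - tanh theta) * tanh B.
  by rewrite sumr_const ssupp -[RHS]mulr_natr mulrAC /a mulrA.
apply: ler_sum => i /muB Bi; apply: le_trans (drift_ge _ _ _ _ _ (mu0 i)); last by lra.
by rewrite ler_wpM2l ?ler_tanh// subr_ge0 ltW.
Qed.

End Achievability.

Theorem Xtilde_test_powerful (R : realType) (theta : R) (theta_gt1 : 1 < theta)
    (s : nat -> nat) (B : nat -> R)
    (s_range : forall n : nat, (0 < n)%N -> (1 <= s n <= n)%N)
    (B_gt0 : forall n : nat, (0 < n)%N -> 0 < B n) :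
  (fun n : nat => Num.sqrt n%:R : R^o) =o_\oo
     (fun n : nat => (s n)%:R * tanh (B n) : R^o) ->
   forall L : nat -> R,
     L n @[n --> \oo] --> +oo ->
     (fun n : nat => L n : R^o) =o_\oo
       (fun n : nat => (Num.sqrt n%:R)^-1 * ((s n)%:R * tanh (B n)) : R^o) ->
     asymptotically_powerful theta s B (Xtilde_test theta L).
Proof.
move=> /eqoP sB L Loo /eqoP LsB; apply/asymptotically_powerfulP => e e0.
have tt := tanh_lt1 theta.
set C1 := 4 + 8 * theta.
have C10 : 0 < C1 by rewrite /C1; lra.
set C2 := 4 * C1 / (1 - tanh theta) ^+ 2.
have C20 : 0 < C2 by apply: divr_gt0; [exact: mulr_gt0|rewrite exprn_gt0 ?subr_gt0].
(* This [eta] makes the bound on the second error [e / 4]; the threshold for [L n] below keeps the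
   first error under [e / 4]. *)
pose eta := Num.sqrt (e / 4 / C2).
have q0 : 0 < e / 4 / C2 by apply: divr_gt0 => //; exact: divr_gt0.
have eta0 : 0 < eta by rewrite sqrtr_gt0.
have c0 : 0 < (1 - tanh theta) / 2 by rewrite divr_gt0 ?subr_gt0.
near=> n.
have n0 : (0 < n)%N by near: n; exists 1%N.
have L0 : Num.sqrt (4 * C1 / e) < L n by near: n; move/cvgryPgt : Loo; apply.
have Lpos : 0 < L n by apply: le_lt_trans L0; rewrite sqrtr_ge0.
have rn0 : 0 < Num.sqrt (n%:R : R) by rewrite sqrtr_gt0 ltr0n.
have /andP[s1 _] := s_range _ n0.
have tB : 0 < tanh (B n).
  have := @tanh_ge_frac R (B n) (ltW (B_gt0 _ n0)); apply: lt_le_trans.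
  by rewrite divr_gt0 ?B_gt0// addr_gt0 ?B_gt0.
have sB0 : 0 < (s n)%:R * tanh (B n) by rewrite mulr_gt0// ltr0n.
have h1 : `|Num.sqrt n%:R : R^o| <= eta * `|(s n)%:R * tanh (B n) : R^o|.
  by near: n; exact: sB.
have h2 : `|L n : R^o| <= (1 - tanh theta) / 2 *
     `|(Num.sqrt n%:R)^-1 * ((s n)%:R * tanh (B n)) : R^o|.
  by near: n; exact: LsB.
rewrite !gtr0_norm// in h1.
have h3 : 0 < (Num.sqrt n%:R)^-1 * ((s n)%:R * tanh (B n)).
  by apply: mulr_gt0; rewrite ?invr_gt0.
rewrite (gtr0_norm Lpos) (gtr0_norm h3) in h2.
apply: (@le_lt_trans _ _ (C1 / L n ^+ 2 + C2 * (Num.sqrt n%:R / ((s n)%:R * tanh (B n))) ^+ 2)).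
  apply: risk_le.
  - exact: Xtilde_type1.
  - by rewrite mulr_ge0 ?sqr_ge0 ?ltW.
  - move=> mu; apply: Xtilde_type2 => //; first exact: B_gt0.
    have -> : 2 * L n * Num.sqrt n%:R = L n * (2 * Num.sqrt n%:R) by ring.
    rewrite -ler_pdivlMr ?mulr_gt0//; apply: le_trans h2 _.
    by rewrite le_eqVlt; apply/orP; left; apply/eqP; field; rewrite gt_eqF.
have -> : e = e / 2 + e / 2 by field.
apply: ltrD.
  rewrite ltr_pdivrMr ?exprn_gt0//.
  have : Num.sqrt (4 * C1 / e) ^+ 2 < L n ^+ 2 by rewrite ltrXn2r ?nnegrE ?sqrtr_ge0// ltW.
  rewrite sqr_sqrtr; last by rewrite divr_ge0 ?mulr_ge0// ltW.
  by rewrite ltr_pdivrMr// => ?; nra.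
apply: (@le_lt_trans _ _ (C2 * eta ^+ 2)).
  apply: ler_wpM2l; first exact: ltW.
  apply: lerXn2r; rewrite ?nnegrE; [exact/ltW/divr_gt0|exact: ltW|].
  by rewrite ler_pdivrMr.
rewrite sqr_sqrtr ?ltW//.
by rewrite mulrC divfK ?gt_eqF//; lra.
Unshelve. all: by end_near.
Qed.

(** * Number of positive spins *)

Section Levels.
Context {R : realType} {n : nat}.
Implicit Types (x y : config n) (i : 'I_n) (mu : 'rV[R]_n).

Definition nplus x : nat := (\sum_i x i)%N.

Lemma nplus_le x : (nplus x <= n)%N.
Proof.
rewrite -[leqRHS]card_ord -sum1_card; apply: leq_sum => i _.
by case: (x i).
Qed.

Lemma mag_nplus x : mag x = 2 * (nplus x)%:R - n%:R :> R.
Proof.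
have -> : n%:R = \sum_(i < n) (1 : R) by rewrite sumr_const card_ord.
rewrite /nplus natr_sum mulr_sumr -sumrB; apply: eq_bigr => i _.
by rewrite /spin; case: (x i) => /=; ring.
Qed.

Lemma nplus_flip i x : nplus (flip i x) = if x i then (nplus x).-1 else (nplus x).+1.
Proof.
rewrite /nplus (bigD1 i)//= [in RHS](bigD1 i)//= ffunE eqxx /=.
rewrite (eq_bigr (fun j => x j : nat)); last first.
  by move=> j /negPf ji; rewrite ffunE ji.
by case: (x i).
Qed.

Lemma sum_plus_const x (a : R) : \sum_(i | x i) a = (nplus x)%:R * a.
Proof.
rewrite big_mkcond /nplus natr_sum mulr_suml; apply: eq_bigr => i _.
by case: (x i); rewrite ?mul1r ?mul0r.
Qed.

Lemma sum_minus_const x (a : R) : \sum_(i | ~~ x i) a = (n%:R - (nplus x)%:R) * a.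
Proof.
apply: (addrI (\sum_(i | x i) a)); transitivity (\sum_(i < n) a).
  by rewrite [RHS](bigID (fun i => x i))/=.
by rewrite sumr_const card_ord sum_plus_const -[LHS]mulr_natl; ring.
Qed.

(* Double counting of the edges of the cube between two consecutive levels. *)
Lemma sum_level_edges j (F : config n -> 'I_n -> R) :
  \sum_(x | nplus x == j) \sum_(i | ~~ x i) F x i =
  \sum_(y | nplus y == j.+1) \sum_(i | y i) F (flip i y) i.
Proof.
rewrite (exchange_big_dep xpredT)//= [RHS](exchange_big_dep xpredT)//=.
apply: eq_bigr => i _; rewrite (reindex_inj (inv_inj (flipK i)))/=.
apply: eq_bigl => y; rewrite nplus_flip ffunE eqxx /= negbK.
case yi : (y i); rewrite ?andbF// !andbT.
have : (0 < nplus y)%N by rewrite /nplus (bigD1 i)//= yi.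
by case: (nplus y).
Qed.

(** The field factor of the weight; the interaction factor depends on [nplus] alone and comes out of
    sums over a level. *)
Definition tilt mu x : R := expR (\sum_i mu ord0 i * spin R x i).

Lemma tilt_gt0 mu x : 0 < tilt mu x.
Proof. exact: expR_gt0. Qed.

Lemma tilt0 x : tilt 0 x = 1.
Proof. by rewrite /tilt big1 ?expR0// => i _; rewrite mxE mul0r. Qed.

Lemma tilt_flip mu i x : x i -> tilt mu (flip i x) = tilt mu x * expR (- (2 * mu ord0 i)).
Proof.
move=> xi; have sx : spin R x i = 1 by rewrite /spin xi.
rewrite /tilt -expRD; congr expR.
rewrite (bigD1 i)//= [in RHS](bigD1 i)//= spin_flip eqxx sx.
rewrite (eq_bigr (fun j => mu ord0 j * spin R x j)); first by ring.
by move=> j /negPf ji; rewrite spin_flip ji.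
Qed.

Definition level mu j : R := \sum_(x | nplus x == j) tilt mu x.

Lemma level_ge0 mu j : 0 <= level mu j.
Proof. by apply: sumr_ge0 => x _; exact/ltW/tilt_gt0. Qed.

Lemma level_gt0 mu j : (j <= n)%N -> 0 < level mu j.
Proof.
move=> jn; pose x : config n := [ffun i : 'I_n => (i < j)%N].
have xj : nplus x == j.
  rewrite /nplus (eq_bigr (fun i : 'I_n => if (i < j)%N then 1%N else 0%N)).
    by rewrite -big_mkcond (big_ord_narrow jn) sum1_card card_ord.
  by move=> i _; rewrite ffunE; case: ltnP.
rewrite /level (bigD1 x)//= ltr_pwDl ?tilt_gt0//.
by apply: sumr_ge0 => y _; exact/ltW/tilt_gt0.
Qed.

Lemma level_edges mu j : (n%:R - j%:R) * level mu j =
  \sum_(y | nplus y == j.+1) tilt mu y * \sum_(i | y i) expR (- (2 * mu ord0 i)).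
Proof.
transitivity (\sum_(x | nplus x == j) \sum_(i | ~~ x i) tilt mu x).
  rewrite mulr_sumr; apply: eq_bigr => x /eqP xj.
  by rewrite sum_minus_const xj.
rewrite (sum_level_edges _ (fun x _ => tilt mu x)); apply: eq_bigr => y _.
by rewrite mulr_sumr; apply: eq_bigr => i yi; rewrite tilt_flip.
Qed.

Lemma level_le_succ mu j : (forall i, 0 <= mu ord0 i) ->
  (n%:R - j%:R) * level mu j <= j.+1%:R * level mu j.+1.
Proof.
move=> mu0; rewrite level_edges /level mulr_sumr; apply: ler_sum => y /eqP yj.
rewrite [leLHS]mulrC; apply: ler_wpM2r; first exact/ltW/tilt_gt0.
rewrite -[leRHS]mulr1 -yj -sum_plus_const; apply: ler_sum => i _.
by rewrite expR_le1 oppr_le0 mulr_ge0.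
Qed.

(** Each exponential in [level_edges] is at least [1 - 2 * tanh (mu ord0 i)], and the subtracted
    terms are enlarged to a sum over all sites. *)
Lemma level_succ_le mu j : (forall i, 0 <= mu ord0 i) ->
  (j.+1%:R - 2 * \sum_i tanh (mu ord0 i)) * level mu j.+1 <= (n%:R - j%:R) * level mu j.
Proof.
move=> mu0; rewrite level_edges /level mulr_sumr; apply: ler_sum => y /eqP yj.
rewrite [leLHS]mulrC; apply: ler_wpM2l; first exact/ltW/tilt_gt0.
rewrite -[j.+1%:R]mulr1 -yj -sum_plus_const mulr_sumr.
apply: (@le_trans _ _ (\sum_(i | y i) (1 - 2 * tanh (mu ord0 i)))).
  rewrite sumrB lerD2l lerN2 [leRHS](bigID (fun i => y i))/= lerDl sumr_ge0// => i _.
  by rewrite mulr_ge0// tanh_ge0.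
(* With [q = expR (mu ord0 i) ^+ 2] the difference of the two sides is
   [(q - 1) ^+ 2 / (q * (q + 1))]. *)
apply: ler_sum => i _; rewrite /tanh.
have -> : 2 * mu ord0 i = mu ord0 i + mu ord0 i by ring.
rewrite opprD expRD expRN.
have := expR_gt0 (mu ord0 i).
have : 1 <= expR (mu ord0 i) by rewrite -expR0 ler_expR.
move: (expR _) => e e1 e0.
have -> : 2 * ((e - e^-1) / (e + e^-1)) = 2 - 4 / (e ^+ 2 + 1).
  by field; rewrite !lt0r_neq0//; nra.
have -> : e^-1 * e^-1 = 1 / e ^+ 2 by field; rewrite lt0r_neq0.
have : 1 <= e ^+ 2 by rewrite expr_ge1// ltW.
move: (e ^+ 2) => q q1; rewrite -subr_ge0.
have -> : 1 / q - (1 - (2 - 4 / (q + 1))) = (q - 1) ^+ 2 / (q * (q + 1)).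
  by field; rewrite !lt0r_neq0//; lra.
by apply: divr_ge0; [exact: sqr_ge0|apply: mulr_ge0; lra].
Qed.

(** At [mu = 0] the two preceding bounds coincide. This is the binomial recursion, since [level 0 j]
    counts the configurations on level [j]. *)
Lemma level0_succ j : (n%:R - j%:R) * level 0 j = j.+1%:R * level 0 j.+1.
Proof.
have h0 i : 0 <= (0 : 'rV[R]_n) ord0 i by rewrite mxE.
apply/eqP; rewrite eq_le level_le_succ//=.
have := level_succ_le 0 j h0; rewrite big1 ?mulr0 ?subr0// => i _.
by rewrite mxE tanh0.
Qed.

Lemma level0_sym j : (j <= n)%N -> level 0 (n - j)%N = level 0 j.
Proof.
move=> jn; rewrite /level; under eq_bigr do rewrite tilt0; under [RHS]eq_bigr do rewrite tilt0.
pose neg x : config n := [ffun i => ~~ x i].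
have negK : involutive neg by move=> x; apply/ffunP => i; rewrite !ffunE negbK.
rewrite (reindex_inj (inv_inj negK))/=; apply: eq_bigl => x.
have : (nplus (neg x) + nplus x)%N = n.
  rewrite /nplus -big_split/= -[RHS]card_ord -sum1_card; apply: eq_bigr => i _.
  by rewrite ffunE; case: (x i).
have := nplus_le x; move: (nplus _) (nplus _) => a b ? ?.
by apply/eqP/eqP; lia.
Qed.

End Levels.

(** * Growth of the likelihood ratio across levels *)

Section LevelRatio.
Context {R : realType} {n : nat} (mu : 'rV[R]_n).
Context (mu_ge0 : forall i, 0 <= mu ord0 i).

(** Up to the ratio of normalizing constants, the likelihood ratio of the permutation-averaged
    alternative to the null on level [j]. *)
Definition level_ratio (j : nat) : R := level mu j / level (0 : 'rV[R]_n) j.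

Lemma level_ratio_gt0 j : (j <= n)%N -> 0 < level_ratio j.
Proof. by move=> jn; rewrite divr_gt0 ?level_gt0. Qed.

Lemma level_ratio_le_succ j : (j < n)%N -> level_ratio j <= level_ratio j.+1.
Proof.
move=> jn; have := level_le_succ mu j mu_ge0; have := level0_succ (R := R) (n := n) j.
have c0 : 0 < level (0 : 'rV[R]_n) j by rewrite level_gt0// ltnW.
have c1 : 0 < level (0 : 'rV[R]_n) j.+1 by rewrite level_gt0.
have nj : 0 < (n%:R - j%:R : R) by rewrite subr_gt0 ltr_nat.
rewrite /level_ratio ler_pdivrMr// mulrAC ler_pdivlMr//.
move: (level 0 j) (level 0 j.+1) (level mu j) (level mu j.+1) c0 c1 => c d g h c0 d0 e1 e2.
rewrite -(ler_pM2l nj) mulrA; apply: le_trans (ler_wpM2r (ltW d0) e2) _.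
by rewrite [in leRHS]mulrCA e1 mulrCA mulrA.
Qed.

Lemma ler_level_ratio j k : (j <= k)%N -> (k <= n)%N -> level_ratio j <= level_ratio k.
Proof.
move=> /subnKC <-; elim: (k - j)%N => [|m IHm]; first by rewrite addn0.
rewrite addnS => h; apply: le_trans (IHm (ltnW h)) _.
exact: level_ratio_le_succ.
Qed.

(** Here twice the sum of the tanh is at most [x * j.+1%:R], so [level_succ_le] bounds the growth by
    [1 / (1 - x)]. This is at most [expR (2 * x)] because [(1 + 2 * x) * (1 - x) >= 1] for
    [0 <= x <= 2^-1]. *)
Lemma level_ratio_succ_le j (x : R) : (j < n)%N -> (n <= 2 * j.+1)%N ->
  4 * \sum_i tanh (mu ord0 i) <= x * n%:R -> x <= 2^-1 ->
  level_ratio j.+1 <= expR (2 * x) * level_ratio j.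
Proof.
move=> jn nj Ax x2.
have := level_succ_le mu j mu_ge0; have := level0_succ (R := R) (n := n) j.
have c0 : 0 < level (0 : 'rV[R]_n) j by rewrite level_gt0// ltnW.
have c1 : 0 < level (0 : 'rV[R]_n) j.+1 by rewrite level_gt0.
have nj0 : 0 < (n%:R - j%:R : R) by rewrite subr_gt0 ltr_nat.
have g1 : 0 < level mu j.+1 by rewrite level_gt0.
have := level_gt0 mu j (ltnW jn).
have j0 : 0 < (j.+1%:R : R) by rewrite ltr0n.
have nj' : (n%:R : R) <= 2 * j.+1%:R by rewrite -natrM ler_nat.
have A0 : 0 <= \sum_i tanh (mu ord0 i) by apply: sumr_ge0 => i _; exact: tanh_ge0.
have n0 : 0 < (n%:R : R) by rewrite ltr0n (leq_ltn_trans _ jn).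
have x0 : 0 <= x by rewrite -(pmulr_lge0 _ n0); lra.
have e2x : 1 <= expR (2 * x) * (1 - x).
  apply: le_trans (ler_wpM2r _ (expR_ge1Dx (2 * x))); nra.
rewrite /level_ratio ler_pdivrMr// mulrA mulrAC ler_pdivlMr//.
move: c0 c1 g1; move: (level 0 j) (level 0 j.+1) (level mu j) (level mu j.+1) => c d g h.
move=> c0 d0 h0 g0 e1.
set A := \sum_i _ in A0 Ax *; set r := j.+1%:R in j0 nj' e1 * => e2.
have e3 : r * (1 - x) * h <= (n%:R - j%:R) * g.
  apply: le_trans e2; apply: ler_wpM2r; first exact: ltW.
  by have := ler_wpM2l x0 nj'; lra.
rewrite -(ler_pM2l nj0) mulrA [in leLHS]mulrAC e1.
have -> : (n%:R - j%:R) * (expR (2 * x) * g * d) = ((n%:R - j%:R) * g) * (expR (2 * x) * d).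
  by ring.
apply: le_trans (ler_wpM2r _ e3); last by rewrite mulr_ge0 ?ltW ?expR_gt0.
have -> : r * (1 - x) * h * (expR (2 * x) * d) = r * d * h * (expR (2 * x) * (1 - x)).
  by ring.
by rewrite ler_peMr// !mulr_ge0// ltW.
Qed.

Lemma level_ratio_le j k (x : R) : (j <= k)%N -> (k <= n)%N -> (n <= 2 * j)%N ->
  4 * \sum_i tanh (mu ord0 i) <= x * n%:R -> x <= 2^-1 ->
  level_ratio k <= expR (2 * x * (k%:R - j%:R)) * level_ratio j.
Proof.
move=> /subnKC <-; elim: (k - j)%N => [|m IHm] h nj Ax x2.
  by rewrite addn0 subrr mulr0 expR0 mul1r.
rewrite addnS in h *.
apply: le_trans (level_ratio_succ_le _ x _ _ Ax x2) _ => //.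
  by apply: leq_trans nj _; rewrite leq_mul2l /= -addnS leq_addr.
apply: le_trans (ler_wpM2l (expR_ge0 _) (IHm (ltnW h) nj Ax x2)) _.
rewrite mulrA -expRD; apply: ler_wpM2r.
  by apply/ltW/level_ratio_gt0/(leq_trans _ (ltnW h))/leq_addr.
by rewrite ler_expR -[(j + m).+1%:R]natr1; lra.
Qed.

End LevelRatio.

(** * Law of the number of positive spins *)

Section LevelLaw.
Context {R : realType} {n : nat} (theta : R) (mu : 'rV[R]_n).

Definition gibbs (j : nat) : R :=
  expR (theta / (2 * n%:R) * ((2 * j%:R - n%:R) ^+ 2 - n%:R)).

Definition law (j : nat) : R := cw_prob theta mu (fun x => nplus x == j).

Lemma lawE j : law j = gibbs j * level mu j / cw_Z theta mu.
Proof.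
rewrite /law /cw_prob /cw_pmf -mulr_suml; congr (_ / _).
rewrite /level mulr_sumr; apply: eq_bigr => x /eqP xj.
by rewrite cw_weightE mag_nplus xj expRD.
Qed.

Lemma law_ge0 j : 0 <= law j.
Proof. exact: cw_prob_ge0. Qed.

Lemma law_seq (r : seq nat) : uniq r ->
  \sum_(j <- r) law j = cw_prob theta mu (fun x => nplus x \in r).
Proof.
move=> ur; rewrite /law /cw_prob [RHS]big_mkcond/=.
under eq_bigr do rewrite big_mkcond.
rewrite exchange_big/=; apply: eq_bigr => x _.
case: ifPn => xr.
  rewrite (bigD1_seq _ xr ur)/= eqxx big1 ?addr0// => j /negPf jx.
  by rewrite eq_sym jx.
by rewrite big_seq big1// => j jr; case: eqP => // xj; rewrite xj jr in xr.
Qed.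

Lemma law_sum (P : pred nat) :
  \sum_(j < n.+1 | P j) law j = cw_prob theta mu (fun x => P (nplus x)).
Proof.
rewrite -(big_mkord P law) -big_filter law_seq ?filter_uniq ?iota_uniq//.
apply: eq_bigl => x; rewrite mem_filter mem_index_iota ltnS nplus_le.
by rewrite leq0n !andbT.
Qed.

Lemma law_sum_le1 (r : seq nat) : uniq r -> \sum_(j <- r) law j <= 1.
Proof. by move=> ur; rewrite law_seq// cw_prob_le1. Qed.

Context (mu_ge0 : forall i, 0 <= mu ord0 i).

(** [gibbs] and the null levels are symmetric under [j -> n - j], which leaves the monotonicity of
    [level_ratio]. *)
Lemma law_reflect j : (2 * j <= n)%N -> law j <= law (n - j).
Proof.
move=> jn; have jn' : (j <= n)%N by lia.
rewrite !lawE; apply: ler_wpM2r; first by rewrite invr_ge0 ltW ?cw_Z_gt0.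
have -> : gibbs (n - j) = gibbs j.
  rewrite /gibbs natrB//.
  by have -> : (2 * (n%:R - j%:R) - n%:R) ^+ 2 = (2 * j%:R - n%:R) ^+ 2 :> R by ring.
rewrite ler_wpM2l ?expR_ge0//.
have := ler_level_ratio mu mu_ge0 j (n - j) ltac:(lia) ltac:(lia).
rewrite /level_ratio level0_sym// ler_pM2r// invr_gt0 level_gt0//.
Qed.

Lemma prob_mag_ge0 : 2^-1 <= cw_prob theta mu (fun x => n <= 2 * nplus x)%N.
Proof.
rewrite -(law_sum (fun j => n <= 2 * j)%N).
have : \sum_(j < n.+1 | ~~ (n <= 2 * j)%N) law j <= \sum_(j < n.+1 | (n <= 2 * j)%N) law j.
  rewrite [leRHS](reindex_inj rev_ord_inj)/=.
  rewrite [leLHS]big_mkcond [leRHS]big_mkcond /=; apply: ler_sum => -[j /= jn] _.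
  rewrite subSS; case: ifPn => h1.
    rewrite ifT; last by lia.
    by apply: law_reflect; lia.
  by case: ifP => // _; exact: law_ge0.
have := cw_pmf_sum1 theta mu.
have -> : \sum_x cw_pmf theta mu x = \sum_(j < n.+1) law j.
  by rewrite (law_sum xpredT).
by rewrite (bigID (fun j : 'I_n.+1 => n <= 2 * j)%N)/=; lra.
Qed.

End LevelLaw.

(** * Concentration on a window *)

Section Window.
Context {R : realType} {n : nat} (theta : R) (mu : 'rV[R]_n).
Context (theta_gt1 : 1 < theta).
Context (mu_ge0 : forall i, 0 <= mu ord0 i).

Lemma cw_prob_cover (P P1 P2 : pred (config n)) :
  (forall x, P x -> P1 x || P2 x) ->
  cw_prob theta mu P <= cw_prob theta mu P1 + cw_prob theta mu P2.
Proof.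
move=> PP; rewrite /cw_prob [leLHS]big_mkcond (big_mkcond P1) (big_mkcond P2).
rewrite -big_split/=; apply: ler_sum => x _.
have := cw_pmf_ge0 theta mu x; have := PP x.
by case: (P x) => [/(_ isT)|_]; case: (P1 x); case: (P2 x) => //= *; lra.
Qed.

(** The Gibbs factor gains [expR (2 * (theta * u))], where [u] is the magnetization midway between
    the two levels, and the level sum gains at least [(n - j) / j.+1]. The product is at least 1
    because [tanh (theta * u) >= u]. *)
Lemma law_le_succ j : (n <= (2 * j).+1)%N ->
  (2 * j).+1%:R - n%:R <= mf_step theta * n%:R -> law theta mu j <= law theta mu j.+1.
Proof.
move=> nj jn; have t1 := theta_gt1.
have [n0|n0] := posnP n.
  rewrite n0 mulr0 subr0 in jn.
  by move: jn; rewrite lern0.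
have rn0 : 0 < (n%:R : R) by rewrite ltr0n.
have d1 := mf_step_lt1 theta t1.
have S1 : j.+1%:R = j%:R + 1 :> R by rewrite natr1.
have S2 : (2 * j).+1%:R = 2 * j%:R + 1 :> R by rewrite -natr1 natrM.
pose u : R := ((2 * j).+1%:R - n%:R) / n%:R.
have u0 : 0 <= u by rewrite divr_ge0 ?subr_ge0 ?ler_nat.
have ud : u <= mf_step theta by rewrite ler_pdivrMr.
have := mf_defect_le0 theta t1 u u0 ud; rewrite tanhE.
have e1 : 1 <= expR (2 * (theta * u)) 
  by rewrite -expR0 ler_expR; apply: mulr_ge0 => //; apply: mulr_ge0 => //; lra.
have gS : gibbs (n := n) theta j.+1 = gibbs (n := n) theta j * expR (2 * (theta * u)).
  rewrite /gibbs -expRD; congr expR.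
  rewrite /u S2 S1; field; exact: lt0r_neq0.
rewrite !lawE gS => eu; apply: ler_wpM2r; first by rewrite invr_ge0 ltW ?cw_Z_gt0.
move: (expR (2 * (theta * u))) e1 eu => e e1 eu.
rewrite -mulrA; apply: ler_wpM2l; first exact: expR_ge0.
have j0 : 0 < (j.+1%:R : R) by rewrite ltr0n.
(* The tanh inequality gives [j + 1/2 <= e * (n - j - 1/2)]; since [1 <= e], adding [1/2] on the
   left and [e / 2] on the right preserves it. *)
have enj : j.+1%:R <= e * (n%:R - j%:R).
  have : u * (e + 1) <= e - 1.
    have -> : e - 1 = (1 - 2 / (e + 1)) * (e + 1) by field; rewrite lt0r_neq0//; lra.
    by rewrite ler_wpM2r//; lra.
  by rewrite /u mulrAC ler_pdivrMr// S1 S2 => h; lra.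
rewrite -(ler_pM2l j0) mulrCA.
apply: le_trans (ler_wpM2r (level_ge0 _ _) enj) _; rewrite -mulrA.
apply: ler_wpM2l; first lra.
exact: level_le_succ.
Qed.

Lemma law_le_add j m : (n <= (2 * j).+1)%N ->
  (2 * (j + m))%:R - n%:R <= mf_step theta * n%:R -> law theta mu j <= law theta mu (j + m).
Proof.
move=> nj; elim: m => [|m IHm] h; first by rewrite addn0.
have h' : (2 * (j + m)).+1%:R <= (2 * (j + m.+1))%:R :> R by rewrite ler_nat; lia.
have h'' : (2 * (j + m))%:R <= (2 * (j + m)).+1%:R :> R by rewrite ler_nat; lia.
apply: le_trans (IHm _) _; first by lra.
by rewrite addnS; apply: law_le_succ; [lia|lra].
Qed.

(* The law of the number of pluses increases away from balance, so a short
   range of levels is dominated by the longer range that follows it. *)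
Lemma prob_mag_small r m : (0 < m)%N ->
  (2 * (r + m) + 2)%:R <= mf_step theta * n%:R ->
  cw_prob theta mu (fun x => n <= 2 * nplus x <= n + 2 * r)%N <= r.+1%:R / m%:R.
Proof.
move=> m0 hrm.
(* [uphalf n] is the least level with [n <= 2 * j], so [r.+1] levels from there cover the event. *)
apply: (@le_trans _ _ (\sum_(j <- iota (uphalf n) r.+1) law theta mu j)).
  rewrite law_seq ?iota_uniq//; apply: le_cw_prob => x /andP[h1 h2].
  by rewrite mem_iota; apply/andP; split; lia.
have -> : r.+1%:R / m%:R = \sum_(j <- iota (uphalf n) r.+1) m%:R^-1 :> R.
  by rewrite big_const_seq count_predT size_iota iter_addr_0 mulr_natl.
rewrite big_seq [leRHS]big_seq; apply: ler_sum => j; rewrite mem_iota => /andP[j1 j2].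
rewrite -[leRHS]mul1r ler_pdivlMr ?ltr0n//.
apply: le_trans (law_sum_le1 theta mu (iota j m) (iota_uniq _ _)).
have -> : law theta mu j * m%:R = \sum_(k <- iota j m) law theta mu j.
  by rewrite big_const_seq count_predT size_iota iter_addr_0 mulr_natr.
rewrite big_seq [leRHS]big_seq; apply: ler_sum => k; rewrite mem_iota => /andP[/subnKC <- k2].
apply: law_le_add; first by lia.
apply: le_trans hrm; rewrite lerBlDr -natrD ler_nat; lia.
Qed.

(** [n] times the defect is the sum of the residuals, the drifts and the errors of replacing cavity
    sums by [mag x]; each such error is at most [4 * theta / n] by [tanh_lip]. *)
Lemma mf_defect_mag_le x : (0 < n)%N ->
  n%:R * `|mf_defect theta (mag x / n%:R)|
    <= `|\sum_i resid theta mu i x| + 2 * \sum_i tanh (mu ord0 i) + 4 * theta.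
Proof.
move=> n0; have t1 := theta_gt1.
have rn0 : 0 < (n%:R : R) by rewrite ltr0n.
have -> : n%:R * `|mf_defect theta (mag x / n%:R)| =
  `|\sum_i resid theta mu i x + \sum_i drift theta mu i x
    + \sum_i (tanh (theta / n%:R * cavity i x) - tanh (theta * (mag x / n%:R)))|.
  rewrite -[X in X * _]ger0_norm ?ltW// -normrM; congr `|_|.
  rewrite -!big_split/= /mf_defect mulrBr mulrCA divff ?mulr1; last exact: lt0r_neq0.
  rewrite (eq_bigr (fun i => spin R x i - tanh (theta * (mag x / n%:R)))); last first.
    by move=> i _; rewrite /resid /drift; ring.
  by rewrite sumrB sumr_const card_ord mulr_natl.
apply: le_trans (ler_normD _ _) _; apply: lerD.
  apply: le_trans (ler_normD _ _) _; apply: lerD => //.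
  rewrite ger0_norm; last by apply: sumr_ge0 => i _; apply: drift_ge0 => //; lra.
  by rewrite mulr_sumr; apply: ler_sum => i _; exact: drift_le.
apply: le_trans (ler_norm_sum _ _ _) _.
have -> : 4 * theta = \sum_(i < n) 4 * (theta / n%:R).
  by rewrite sumr_const card_ord -[RHS]mulr_natr -mulrA divfK ?gt_eqF.
apply: ler_sum => i _; apply: le_trans (tanh_lip _ _) _; rewrite ler_wpM2l//.
rewrite (magE i) (_ : _ - _ = - (theta / n%:R * spin R x i)); last by ring.
by rewrite normrN normrM norm_spin mulr1 ger0_norm// divr_ge0//; lra.
Qed.

(** The first condition keeps away from the root 0 and the negative root of the defect. *)
Definition mf_window (K : R) (j : nat) : bool :=
  (mf_step theta * n%:R <= 2 * j%:R - n%:R) &&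
  (n%:R * `|mf_defect theta ((2 * j%:R - n%:R) / n%:R)| <= K * Num.sqrt n%:R).

Definition mf_gap : R := - mf_defect theta (mf_step theta).

Lemma mf_gap_gt0 : 0 < mf_gap.
Proof. by rewrite oppr_gt0 mf_defect_step_lt0. Qed.

(** Chosen so that Chebyshev's inequality at [resid_scale * Num.sqrt n%:R] leaves probability at
    most 1/8. *)
Definition resid_scale : R := Num.sqrt (8 * (4 + 8 * theta)).

Definition window_scale (C : R) : R := resid_scale + 2 * C + 4 * theta.

Lemma window_scale_ge0 C : 0 <= C -> 0 <= window_scale C.
Proof.
move=> C0; have t1 := theta_gt1.
by rewrite /window_scale; have := sqrtr_ge0 (8 * (4 + 8 * theta)); rewrite -/resid_scale; lra.
Qed.

(** The 1/4 is 1/2 - 1/8 - 1/8: from the event of nonnegative magnetization, a short range near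
    balance and the Chebyshev tail are removed. *)
Lemma prob_window (C : R) : (0 < n)%N -> 0 <= C ->
  \sum_i tanh (mu ord0 i) <= C * Num.sqrt n%:R ->
  18 * (window_scale C * mf_step theta / mf_gap) * Num.sqrt n%:R + 38
    <= mf_step theta * n%:R ->
  4^-1 <= cw_prob theta mu (fun x => mf_window (window_scale C) (nplus x)).
Proof.
move=> n0 C0 AC big_n; have t1 := theta_gt1.
have rn0 : 0 < (n%:R : R) by rewrite ltr0n.
have q0 : 0 < Num.sqrt (n%:R : R) by rewrite sqrtr_gt0.
have q1 : 1 <= Num.sqrt (n%:R : R) by rewrite -[leLHS]sqrtr1 ler_wsqrtr// ler1n.
have d0 := mf_step_gt0 theta t1; have g0 := mf_gap_gt0.
have K0 := window_scale_ge0 C C0.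
set K2 := window_scale C * mf_step theta / mf_gap in big_n *.
have K20 : 0 <= K2.
  by apply: divr_ge0; [apply: mulr_ge0 => //|]; exact: ltW.
pose r := (Num.truncn (K2 * Num.sqrt n%:R)).+1.
have Kq0 : 0 <= K2 * Num.sqrt n%:R by apply: mulr_ge0 => //; exact: ltW.
have r1 : K2 * Num.sqrt n%:R <= r%:R by apply/ltW; exact: truncnS_gt.
have r2 : r%:R <= K2 * Num.sqrt n%:R + 1.
  by rewrite /r -natr1 lerD2r truncn_le.
(* Taking [m := 8 * r.+1] in [prob_mag_small] gives 1/8 and requires room for [18 * r + 18]; as [r]
   exceeds [K2 * Num.sqrt n%:R] by at most 1, the constants 18 and 38 suffice. *)
have small : cw_prob theta mu (fun x => n <= 2 * nplus x <= n + 2 * r)%N <= 8^-1.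
  apply: le_trans (prob_mag_small r (8 * r.+1) _ _) _ => //.
    rewrite natrD natrM natrD natrM -natr1; lra.
  by rewrite natrM invfM mulrCA divff ?mulr1// pnatr_eq0.
have tail : cw_prob theta mu
    (fun x => resid_scale * Num.sqrt n%:R <= `|\sum_i resid theta mu i x|) <= 8^-1.
  have th0 : 0 <= theta by lra.
  have s0 : 0 <= resid_scale * Num.sqrt n%:R by rewrite mulr_ge0 ?sqrtr_ge0.
  have cheb := resid_chebyshev theta mu _ th0 s0.
  have D0 : 0 < (4 + 8 * theta) * n%:R by apply: mulr_gt0 => //; lra.
  have q2 : (resid_scale * Num.sqrt n%:R) ^+ 2 = 8 * ((4 + 8 * theta) * n%:R).
    by rewrite exprMn !sqr_sqrtr ?mulrA// ?ler0n//; lra.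
  rewrite q2 in cheb; rewrite -(ler_pM2r D0); lra.
have half := prob_mag_ge0 theta mu mu_ge0.
suff : cw_prob theta mu (fun x => n <= 2 * nplus x)%N <=
   cw_prob theta mu (fun x => mf_window (window_scale C) (nplus x)) + (8^-1 + 8^-1).
  by lra.
apply: le_trans (lerD (lexx _) (lerD small tail)).
apply: le_trans (lerD (lexx _) (cw_prob_cover _ _ _ _)); last by move=> x; exact.
apply: cw_prob_cover => x nx /=.
have [//|] := boolP (resid_scale * Num.sqrt n%:R <= `|\sum_i resid theta mu i x|).
  by rewrite !orbT.
rewrite -ltNge orbF nx/= => Dsmall.
rewrite /mf_window -mag_nplus.
have dm : n%:R * `|mf_defect theta (mag x / n%:R)| <= window_scale C * Num.sqrt n%:R.
  apply: le_trans (mf_defect_mag_le x n0) _; rewrite /window_scale; nra.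
(* Below [mf_step] a small defect forces [mag x <= K2 * Num.sqrt n%:R] by the chord bound, so the
   configuration falls into the short range near balance. *)
rewrite dm andbT; have [//|/= mx] := leP (mf_step theta * n%:R) (mag x).
rewrite -(ler_nat R) natrD 2!natrM.
have m0 : 0 <= mag x :> R by rewrite mag_nplus subr_ge0 -natrM ler_nat.
suff : mag x <= K2 * Num.sqrt n%:R by have := mag_nplus (R := R) x; lra.
have u0 : 0 <= mag x / n%:R :> R by rewrite divr_ge0.
have ud : mag x / n%:R <= mf_step theta by rewrite ler_pdivrMr// ltW.
have := mf_defect_le theta t1 _ u0 ud.
have dfl : - (window_scale C * Num.sqrt n%:R) <= n%:R * mf_defect theta (mag x / n%:R).
  by rewrite lerNl -mulrN; apply: le_trans dm; rewrite ler_pM2l// -normrN ler_norm.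
rewrite -(ler_pM2l rn0) => /(le_trans dfl).
have -> : n%:R * (mag x / n%:R * (mf_defect theta (mf_step theta) / mf_step theta)) =
  - (mag x * mf_gap / mf_step theta).
  by rewrite /mf_gap; field; rewrite !lt0r_neq0.
rewrite lerN2 ler_pdivrMr// => h.
by rewrite /K2 mulrAC ler_pdivlMr// mulrAC.
Qed.

(** The defect varies by at most [2 * K / Num.sqrt n%:R] over the window. The lower bound on [n]
    makes [mf_defect_expand] applicable with slope [mf_gap / 2], and one level is [2 / n] in
    magnetization. *)
Lemma window_width (K : R) j k : (0 < n)%N -> (j <= k <= n)%N ->
  2 * K <= mf_gap * Num.sqrt n%:R -> mf_window K j -> mf_window K k ->
  k%:R - j%:R <= 2 * K / mf_gap * Num.sqrt n%:R.
Proof.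
move=> n0 /andP[jk kn] big_n /andP[j1 j2] /andP[k1 k2].
have t1 := theta_gt1; have g0 := mf_gap_gt0.
have rn0 : 0 < (n%:R : R) by rewrite ltr0n.
have q0 : 0 < Num.sqrt (n%:R : R) by rewrite sqrtr_gt0.
have jn : (j%:R : R) <= n%:R by rewrite ler_nat (leq_trans jk).
have jk' : (j%:R : R) <= k%:R by rewrite ler_nat.
set u := (2 * j%:R - n%:R) / n%:R in j2; set v := (2 * k%:R - n%:R) / n%:R in k2.
have du : mf_step theta <= u by rewrite ler_pdivlMr.
have uv : u <= v by rewrite ler_pM2r ?invr_gt0//; lra.
have u1 : u <= 1 by rewrite ler_pdivrMr//; lra.
have nu : - (K * Num.sqrt n%:R) <= n%:R * mf_defect theta u.
  by rewrite lerNl -mulrN; apply: le_trans j2; rewrite ler_pM2l// -normrN ler_norm.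
have nv : n%:R * mf_defect theta v <= K * Num.sqrt n%:R.
  by apply: le_trans k2; rewrite ler_pM2l// ler_norm.
have qq : (n%:R : R) = Num.sqrt n%:R * Num.sqrt n%:R by rewrite -expr2 sqr_sqrtr// ltW.
have fu : mf_defect theta (mf_step theta) / 2 <= mf_defect theta u.
  rewrite -(ler_pM2l rn0); apply: le_trans nu; rewrite lerNr.
  have -> : - (n%:R * (mf_defect theta (mf_step theta) / 2)) = n%:R * (mf_gap / 2).
    by rewrite /mf_gap; field.
  have := ler_wpM2r (ltW q0) big_n; rewrite -[X in _ <= X]mulrA -qq; lra.
have := mf_defect_expand theta t1 u v du uv u1 fu.
rewrite -mulNr -/mf_gap -(ler_pM2l rn0) => h.
rewrite mulrAC ler_pdivlMr//.
have vu : n%:R * (v - u) = 2 * (k%:R - j%:R) by rewrite /u /v; field; exact: lt0r_neq0.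
have : n%:R * (mf_gap / 2 * (v - u)) = (k%:R - j%:R) * mf_gap.
  by rewrite mulrCA vu; field.
by lra.
Qed.

(** Upwards, each step costs at most [expR (2 * x)] with [x = 4 * C / Num.sqrt n%:R], and the window
    width is of order [Num.sqrt n%:R], so the square roots cancel. Downwards, monotonicity
    suffices. *)
Lemma window_ratio (C : R) j k : (0 < n)%N -> 0 <= C ->
  \sum_i tanh (mu ord0 i) <= C * Num.sqrt n%:R ->
  2 * window_scale C <= mf_gap * Num.sqrt n%:R -> 8 * C <= Num.sqrt n%:R ->
  (j <= n)%N -> (k <= n)%N ->
  mf_window (window_scale C) j -> mf_window (window_scale C) k ->
  level_ratio mu k <= expR (16 * C * window_scale C / mf_gap) * level_ratio mu j.
Proof.
move=> n0 C0 AC big1 big2 jn kn wj wk; have t1 := theta_gt1.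
have K0 := window_scale_ge0 C C0; have g0 := mf_gap_gt0.
have rn0 : 0 < (n%:R : R) by rewrite ltr0n.
have q0 : 0 < Num.sqrt (n%:R : R) by rewrite sqrtr_gt0.
have [kj|/ltnW jk] := leqP k j.
  apply: le_trans (ler_level_ratio mu mu_ge0 k j kj jn) _.
  apply: ler_peMl; first by rewrite ltW ?level_ratio_gt0.
  rewrite -expR0 ler_expR; apply: divr_ge0; last exact: ltW.
  by apply: mulr_ge0 => //; apply: mulr_ge0.
have nj : (n <= 2 * j)%N.
  have /andP[h _] := wj; have d0 := mf_step_gt0 theta t1.
  rewrite -(ler_nat R) natrM -subr_ge0; apply: le_trans h.
  by rewrite mulr_ge0// ltW.
have Ax : 4 * \sum_i tanh (mu ord0 i) <= 4 * C / Num.sqrt n%:R * n%:R.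
  rewrite [X in _ / _ * X](_ : _ = Num.sqrt n%:R * Num.sqrt n%:R); last first.
    by rewrite -expr2 sqr_sqrtr// ltW.
  by rewrite mulrA divfK ?gt_eqF// -mulrA ler_pM2l.
have x2 : 4 * C / Num.sqrt n%:R <= 2^-1 by rewrite ler_pdivrMr//; lra.
apply: le_trans (level_ratio_le mu mu_ge0 j k _ jk kn nj Ax x2) _.
apply: ler_wpM2r; first by rewrite ltW ?level_ratio_gt0.
rewrite ler_expR; have := window_width _ j k n0 _ big1 wj wk; rewrite jk kn => /(_ isT) w.
have x0 : 0 <= 2 * (4 * C / Num.sqrt n%:R) 
  by apply: mulr_ge0 => //; apply: divr_ge0; [exact: mulr_ge0|exact: ltW].
apply: le_trans (ler_wpM2l x0 w) _.
rewrite le_eqVlt; apply/orP; left; apply/eqP.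
by move: (window_scale C) mf_gap g0 => a b b0; field; rewrite !lt0r_neq0.
Qed.

End Window.

(** * Averaging over permutations *)

Section Permutations.
Context {R : realType} {n : nat} (theta : R).
Implicit Types (x y : config n) (p q : {perm 'I_n}) (mu : 'rV[R]_n).

Definition perm_config p x : config n := [ffun i => x (p i)].

Lemma perm_configK p : cancel (perm_config p) (perm_config p^-1).
Proof. by move=> x; apply/ffunP => i; rewrite !ffunE permKV. Qed.

Lemma perm_config_inj p : injective (perm_config p).
Proof. exact: can_inj (perm_configK p). Qed.

Lemma nplus_perm p x : nplus (perm_config p x) = nplus x.
Proof.
rewrite /nplus [RHS](reindex_inj (@perm_inj _ p)).
by apply: eq_bigr => i _; rewrite ffunE.
Qed.

Lemma nplus_eq_perm x y : nplus x = nplus y -> exists p, y = perm_config p x.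
Proof.
move=> xy.
have cnt (z : config n) : count_mem true [tuple z i | i < n] = nplus z.
  rewrite -sum1_count big_map big_enum_cond /= /nplus big_mkcond.
  by apply: eq_bigr => i _; case: (z i).
have cnt0 (z : config n) : count_mem false [tuple z i | i < n] = (n - nplus z)%N.
  rewrite -cnt -[X in (X - _)%N](size_tuple [tuple z i | i < n]).
  rewrite -(count_predC (pred1 true)) addKn; apply: eq_count => -[] //.
have /tuple_permP [p e] : perm_eq [tuple y i | i < n] [tuple x i | i < n].
  by apply/allP => -[] _; rewrite /= ?cnt ?cnt0 xy.
exists p; apply/ffunP => i; rewrite ffunE.
have /(congr1 (fun t => tnth t i)) := val_inj e.
by rewrite !tnth_mktuple.
Qed.

Lemma cw_weight_perm mu p x :
  cw_weight theta (col_perm p mu) (perm_config p x) = cw_weight theta mu x.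
Proof.
rewrite !cw_weightE !mag_nplus nplus_perm; congr (expR (_ + _)).
rewrite [RHS](reindex_inj (@perm_inj _ p)).
by apply: eq_bigr => i _; rewrite mxE /spin ffunE.
Qed.

Lemma cw_pmf_perm mu p x :
  cw_pmf theta (col_perm p mu) (perm_config p x) = cw_pmf theta mu x.
Proof.
rewrite /cw_pmf cw_weight_perm; congr (_ / _).
rewrite /cw_Z (reindex_inj (@perm_config_inj p)).
by apply: eq_bigr => y _; rewrite cw_weight_perm.
Qed.

Lemma cw_prob_perm mu p (P : pred nat) :
  cw_prob theta (col_perm p mu) (fun x => P (nplus x)) =
  cw_prob theta mu (fun x => P (nplus x)).
Proof.
rewrite /cw_prob (reindex_inj (@perm_config_inj p)).
by apply: eq_big => [x|x _]; rewrite ?nplus_perm ?cw_pmf_perm.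
Qed.

(** [n!] times the uniform mixture of the permuted alternatives, left unnormalized to spare
    divisions. *)
Definition perm_sum mu x : R := \sum_(p : {perm 'I_n}) cw_pmf theta (col_perm p mu) x.

Lemma perm_sum_level mu x y : nplus x = nplus y -> perm_sum mu x = perm_sum mu y.
Proof.
move=> /nplus_eq_perm[q ->]; rewrite /perm_sum [RHS](reindex_inj (mulgI q)).
by apply: eq_bigr => p _; rewrite col_permM cw_pmf_perm.
Qed.

(** Being constant on levels, [perm_sum mu] is [n!] times the law of the level divided by the number
    [level 0 j] of its configurations. *)
Lemma perm_sumE mu x : perm_sum mu x =
  n`!%:R * cw_pmf theta 0 x * (level_ratio mu (nplus x) * cw_Z theta (0 : 'rV[R]_n) / cw_Z theta mu).
Proof.
set j := nplus x.
have c0 : 0 < level (0 : 'rV[R]_n) j by rewrite level_gt0 ?nplus_le.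
have h : perm_sum mu x * level (0 : 'rV[R]_n) j = n`!%:R * law theta mu j.
  rewrite /level mulr_sumr; under eq_bigr do rewrite tilt0 mulr1.
  rewrite (eq_bigr (perm_sum mu)); last by move=> y /eqP yj; apply: perm_sum_level.
  rewrite exchange_big/=.
  transitivity (\sum_(p : {perm 'I_n}) law theta mu j).
    by apply: eq_bigr => p _; exact: (cw_prob_perm mu p (pred1 j)).
  by rewrite sumr_const card_Sn mulr_natl.
apply: (mulIf (lt0r_neq0 c0)); rewrite h lawE /level_ratio /cw_pmf cw_weightE mag_nplus.
rewrite [\sum_(i < n) _]big1 ?addr0 -?/(gibbs _); last by move=> i _; rewrite mxE mul0r.
have := cw_Z_gt0 theta mu; have := cw_Z_gt0 theta (0 : 'rV[R]_n).
rewrite -/j -/(gibbs _) /gibbs; move: (expR _) (cw_Z _ _) (cw_Z _ _) (level mu j) c0.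
move: (level 0 j) => c a z0 z1 g c0 z00 z10.
by field; rewrite !lt0r_neq0.
Qed.

(** Le Cam's argument. On [W], where the test rejects, the mixture is at most [lam] times the null;
    where it accepts, the mixture is part of the second error, and [1 <= lam]. Hence the mixture
    gives [W] mass at most [lam] times the risk. *)
Lemma risk_ge_average s (B : R) (T : test n) mu (W : pred nat) (lam p : R) :
  (forall q, Xi s B (col_perm q mu)) -> 1 <= lam ->
  (forall x, W (nplus x) -> perm_sum mu x <= n`!%:R * lam * cw_pmf theta 0 x) ->
  p <= cw_prob theta mu (fun x => W (nplus x)) ->
  p / lam <= risk theta s B T.
Proof.
move=> XB lam1 hW hp; have lam0 : 0 < lam by lra.
have f0 : 0 < (n`!%:R : R) by rewrite ltr0n fact_gt0.
have ps0 x : 0 <= perm_sum mu x by apply: sumr_ge0 => q _; exact: cw_pmf_ge0.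
rewrite ler_pdivrMr// -(ler_pM2l f0).
have -> : n`!%:R * (risk theta s B T * lam) =
    lam * \sum_(q : {perm 'I_n}) risk theta s B T.
  by rewrite sumr_const card_Sn -[X in _ = _ * X]mulr_natr; ring.
apply: (@le_trans _ _ (lam * \sum_(q : {perm 'I_n})
  (cw_prob theta (0 : 'rV[R]_n) (fun x => T x)
   + cw_prob theta (col_perm q mu) (fun x => ~~ T x)))); last first.
  rewrite ler_pM2l//; apply: ler_sum => q _; exact/risk_ge/XB.
apply: (@le_trans _ _ (\sum_(q : {perm 'I_n})
    cw_prob theta (col_perm q mu) (fun x => W (nplus x)))).
  under eq_bigr do rewrite cw_prob_perm.
  by rewrite sumr_const card_Sn -[leRHS]mulr_natl ler_pM2l.
rewrite big_split/= sumr_const card_Sn -[X in _ <= _ * (X + _)]mulr_natl.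
rewrite /cw_prob (exchange_big_dep (fun x => W (nplus x)))//=.
rewrite [X in _ <= _ * (_ + X)](exchange_big_dep (fun x => ~~ T x))//= -/(perm_sum _ _).
rewrite mulr_sumr [leLHS]big_mkcond (big_mkcond T) (big_mkcond (fun x => ~~ T x)).
rewrite -big_split/= mulr_sumr; apply: ler_sum => x _.
rewrite -/(perm_sum mu x).
have := hW x; have := ps0 x; have := cw_pmf_ge0 theta (0 : 'rV[R]_n) x.
case: (W _) => [u0 v0 /(_ isT) h|u0 v0 _]; case: (T x) => /=; rewrite ?addr0 ?add0r.
- by apply: le_trans h _; rewrite [leRHS]mulrA [lam * _]mulrC.
- exact: ler_peMl.
- by apply: mulr_ge0; [exact: ltW|apply: mulr_ge0 => //; exact: ltW].
- by apply: mulr_ge0 => //; exact: ltW.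
Qed.

End Permutations.

(** * Lower bound on the risk *)

Section LowerBound.
Context {R : realType} (theta : R) (theta_gt1 : 1 < theta).

(** The exponential bounds the variation of [level_ratio] over the window; the 4 is the inverse of
    the lower bound on the window's null probability. *)
Definition window_constant (C : R) : R :=
  4 * expR (16 * C * window_scale theta C / mf_gap theta).

Lemma window_constant_ge1 C : 0 <= C -> 1 <= window_constant C.
Proof.
move=> C0; have K0 := window_scale_ge0 theta theta_gt1 C C0.
have g0 := mf_gap_gt0 theta theta_gt1.
have : 1 <= expR (16 * C * window_scale theta C / mf_gap theta).
  rewrite -expR0 ler_expR; apply: divr_ge0; last exact: ltW.
  by apply: mulr_ge0 => //; apply: mulr_ge0.
by rewrite /window_constant; lra.
Qed.

Lemma risk_lower_bound n s (B C : R) (T : test n) : (0 < n)%N -> (s <= n)%N ->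
  0 < B -> 0 <= C -> s%:R * tanh B <= C * Num.sqrt n%:R ->
  18 * (window_scale theta C * mf_step theta / mf_gap theta) * Num.sqrt n%:R + 38
    <= mf_step theta * n%:R ->
  2 * window_scale theta C <= mf_gap theta * Num.sqrt n%:R ->
  8 * C <= Num.sqrt n%:R ->
  4^-1 / window_constant C <= risk theta s B T.
Proof.
move=> n0 sn B0 C0 sC lg1 lg2 lg3.
pose A := [set i in take s (enum 'I_n)]%SET.
have cA : #|A| = s.
  rewrite cardsE; have /card_uniqP -> := take_uniq s (enum_uniq 'I_n).
  by rewrite size_takel// size_enum_ord.
(* The weakest signal allowed on [s] sites, with tanh sum exactly [s%:R * tanh B]. *)
pose mu : 'rV[R]_n := \row_i (if i \in A then B else 0).
have mu0 i : 0 <= mu ord0 i by rewrite mxE; case: ifP => // _; exact: ltW.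
have sum_tanh : \sum_i tanh (mu ord0 i) = s%:R * tanh B.
  have outside : \sum_(i | i \notin A) tanh (mu ord0 i) = 0.
    by apply: big1 => i /negPf iA; rewrite mxE iA tanh0.
  rewrite (bigID (mem A))/= outside addr0.
  rewrite (eq_bigr (fun=> tanh B)); last by move=> i iA; rewrite mxE iA.
  by rewrite sumr_const cA mulr_natl.
have XB q : Xi s B (col_perm q mu).
  have sq i : (col_perm q mu ord0 i != 0) = (q i \in A).
    by rewrite !mxE; case: ifP => _; rewrite ?eqxx// gt_eqF.
  split=> [|i]; last by rewrite inE sq !mxE => ->.
  rewrite -cA -(card_preimset A (@perm_inj _ q)); congr #|pred_of_set _|.
  by apply/setP => i; rewrite !inE sq inE.
have zz0 := cw_Z_gt0 theta (0 : 'rV[R]_n); have zz := cw_Z_gt0 theta mu.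
pose W j := (j <= n)%N && mf_window (n := n) theta (window_scale theta C) j.
have sum0 : \sum_i tanh ((0 : 'rV[R]_n) ord0 i) <= C * Num.sqrt n%:R.
  by rewrite big1 ?mulr_ge0 ?sqrtr_ge0// => i _; rewrite mxE tanh0.
have W0 : 4^-1 <= cw_prob theta (0 : 'rV[R]_n) (fun x => W (nplus x)).
  apply: le_trans (prob_window theta 0 theta_gt1 _ C n0 C0 sum0 lg1) _.
    by move=> i; rewrite mxE.
  by apply: le_cw_prob => x; rewrite /W nplus_le.
rewrite -sum_tanh in sC.
apply: (risk_ge_average theta s B T mu W _ _ XB (window_constant_ge1 C C0)); last first.
  apply: le_trans (prob_window theta mu theta_gt1 mu0 C n0 C0 sC lg1) _.
  by apply: le_cw_prob => x; rewrite /W nplus_le.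
move=> x /andP[jn jW]; rewrite perm_sumE -[leRHS]mulrA.
have f0 : 0 <= (n`!%:R : R) by rewrite ler0n.
rewrite -mulrA; apply: ler_wpM2l => //; rewrite [leRHS]mulrC.
apply: ler_wpM2l; first exact: cw_pmf_ge0.
move: (nplus x) jn jW => j jn jW; rewrite /window_constant; set E := expR _.
have E0 : 0 < E by exact: expR_gt0.
(* The normalizing constants need not be computed. On every window level [level_ratio] is at least
   [level_ratio mu j / E]; summed against the null law of the window, of mass at least 1/4, this
   bounds the left side by the window's probability under [mu], hence by 1. *)
suff : level_ratio mu j / E * (cw_Z theta (0 : 'rV[R]_n) / cw_Z theta mu) * 4^-1 <= 1.
  have -> : level_ratio mu j / E * (cw_Z theta (0 : 'rV[R]_n) / cw_Z theta mu) * 4^-1 =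
    (level_ratio mu j * cw_Z theta (0 : 'rV[R]_n) / cw_Z theta mu) / (4 * E).
    by field; rewrite !lt0r_neq0.
  by rewrite ler_pdivrMr ?mul1r ?mulr_gt0.
apply: le_trans (cw_prob_le1 theta mu (fun x => W (nplus x))).
have rho0 : 0 <= level_ratio mu j / E * (cw_Z theta (0 : 'rV[R]_n) / cw_Z theta mu).
  apply: mulr_ge0; apply: divr_ge0; rewrite ltW//; exact: level_ratio_gt0.
apply: le_trans (ler_wpM2l rho0 W0) _.
rewrite -!law_sum mulr_sumr; apply: ler_sum => k /andP[kn kW].
have c0 : 0 < level (0 : 'rV[R]_n) k by rewrite level_gt0.
have := window_ratio theta mu theta_gt1 mu0 C k j n0 C0 sC lg2 lg3 kn jn kW jW.
rewrite -/E !lawE -ler_pdivrMl// [E^-1 * _]mulrC => h.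
have -> : level mu k = level_ratio mu k * level (0 : 'rV[R]_n) k.
  by rewrite /level_ratio divfK// lt0r_neq0.
have -> : level_ratio mu j / E * (cw_Z theta (0 : 'rV[R]_n) / cw_Z theta mu) *
   (gibbs (n := n) theta k * level (0 : 'rV[R]_n) k / cw_Z theta (0 : 'rV[R]_n)) =
   level_ratio mu j / E * (gibbs (n := n) theta k * level (0 : 'rV[R]_n) k / cw_Z theta mu).
  by field; rewrite !lt0r_neq0.
have -> : gibbs (n := n) theta k * (level_ratio mu k * level (0 : 'rV[R]_n) k) / cw_Z theta mu =
   level_ratio mu k * (gibbs (n := n) theta k * level (0 : 'rV[R]_n) k / cw_Z theta mu).
  by ring.
apply: ler_wpM2r => //; apply: divr_ge0; last exact: ltW.
by apply: mulr_ge0; [exact: expR_ge0|exact: ltW].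
Qed.

Lemma near_sqrt_ge (M : R) : \forall n \near \oo, M <= Num.sqrt n%:R.
Proof.
exists (Num.truncn (M ^+ 2)).+1 => // n /= Mn.
apply: le_trans (ler_norm M) _; rewrite -sqrtr_sqr ler_wsqrtr//.
by apply: le_trans (ltW (truncnS_gt (M ^+ 2))) _; rewrite ler_nat.
Qed.

Theorem no_powerful_test (s : nat -> nat) (B : nat -> R)
    (s_range : forall n : nat, (0 < n)%N -> (1 <= s n <= n)%N)
    (B_gt0 : forall n : nat, (0 < n)%N -> 0 < B n) :
  (fun n : nat => (s n)%:R * tanh (B n) : R^o) =O_\oo
     (fun n : nat => Num.sqrt n%:R : R^o) ->
  ~ exists T : forall n : nat, test n, asymptotically_powerful theta s B T.
Proof.
move=> /eqOP[M [_ hM]] [T /asymptotically_powerfulP powT].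
(* The big-O bound holds for every constant above [M]; this one is also nonnegative. *)
pose C := `|M| + 1.
have C0 : 0 <= C by rewrite addr_ge0.
have MC : M < C by rewrite (le_lt_trans (ler_norm M))// ltrDl.
have K0 := window_scale_ge0 theta theta_gt1 C C0.
have g0 := mf_gap_gt0 theta theta_gt1; have d0 := mf_step_gt0 theta theta_gt1.
have L1 := window_constant_ge1 C C0.
have e0 : 0 < 4^-1 / window_constant C by rewrite divr_gt0//; lra.
set K2 := 18 * (window_scale theta C * mf_step theta / mf_gap theta).
near \oo => n.
have n0 : (0 < n)%N by near: n; exists 1%N.
have := n0 => /s_range /andP[_ sn].
have q1 : 1 <= Num.sqrt (n%:R : R) by near: n; exact: near_sqrt_ge.
have hC : `|(s n)%:R * tanh (B n) : R^o| <= C * `|Num.sqrt n%:R : R^o|.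
  by near: n; exact: hM.
(* Since [Num.sqrt n%:R >= 1], the additive 38 is absorbed into the coefficient of
   [Num.sqrt n%:R]. *)
have h1 : (K2 + 38) / mf_step theta <= Num.sqrt n%:R by near: n; exact: near_sqrt_ge.
have h2 : 2 * window_scale theta C / mf_gap theta <= Num.sqrt n%:R.
  by near: n; exact: near_sqrt_ge.
have h3 : 8 * C <= Num.sqrt n%:R by near: n; exact: near_sqrt_ge.
have : risk theta (s n) (B n) (T n) < 4^-1 / window_constant C by near: n; exact: powT.
apply/negP; rewrite -leNgt; apply: risk_lower_bound => //.
- exact: B_gt0.
- rewrite (ger0_norm (sqrtr_ge0 _)) in hC.
  exact: le_trans (ler_norm _) hC.
- rewrite -/K2; move: h1; rewrite ler_pdivrMr// => h1.
  have qq : (n%:R : R) = Num.sqrt n%:R * Num.sqrt n%:R by rewrite -expr2 sqr_sqrtr// ler0n.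
  have := ler_wpM2r (le_trans ler01 q1) h1; rewrite [X in _ <= X]mulrAC -qq; lra.
- by rewrite [leRHS]mulrC -ler_pdivrMr.
Unshelve. all: by end_near.
Qed.

End LowerBound.

Theorem theorem2 (R : realType) (theta : R) (theta_gt1 : 1 < theta)
    (s : nat -> nat) (B : nat -> R)
    (s_range : forall n : nat, (0 < n)%N -> (1 <= s n <= n)%N)
    (B_gt0 : forall n : nat, (0 < n)%N -> 0 < B n) :
  ((fun n : nat => Num.sqrt n%:R : R^o) =o_\oo
     (fun n : nat => (s n)%:R * tanh (B n) : R^o) ->
   forall L : nat -> R,
     L n @[n --> \oo] --> +oo ->
     (fun n : nat => L n : R^o) =o_\oo
       (fun n : nat => (Num.sqrt n%:R)^-1 * ((s n)%:R * tanh (B n)) : R^o) ->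
     asymptotically_powerful theta s B (Xtilde_test theta L))
  /\
  ((fun n : nat => (s n)%:R * tanh (B n) : R^o) =O_\oo
     (fun n : nat => Num.sqrt n%:R : R^o) ->
   ~ exists T : forall n : nat, test n, asymptotically_powerful theta s B T).
Proof.
split=> [sB L Loo LsB|sB].
- exact: Xtilde_test_powerful.
- exact: no_powerful_test.
Qed.
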